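(* Let $w$ be a positive integer and $\phi=\frac{1+\sqrt5}{2}$. The value of the on-line chain partition game for up-growing semi-orders of width $w$ is $\lfloor \phi\cdot w\rfloor$. That is: (i) Algorithm has a strategy that, against every presentation by Spoiler of an up-growing semi-order of width at most $w$, uses at most $\lfloor \phi w\rfloor$ chains; and (ii) Spoiler has a strategy presenting an up-growing semi-order of width $w$ that forces every Algorithm to use at least $\lfloor \phi w\rfloor$ chains.
   Context: A semi-order is a partial order $P$ admitting a unit interval representation: a map $I$ from $P$ to closed real intervals of length $1$ such that $x<y$ in $P$ iff $I(x)$ lies entirely to the left of $I(y)$ (equivalently, $P$ contains neither two disjoint 2-element chains with no comparabilities between them, i.e. $\mathbf{2+2}$, nor a 3-element chain together with a point incomparable to all three, i.e. $\mathbf{3+1}$). The on-line chain partition game is played between Spoiler and Algorithm: Spoiler presents the points of a finite poset one at a time, revealing with each new point its comparabilities with all previously presented points; Algorithm immediately and irrevocably assigns each new point to a chain, so that at every moment the assignment is a partition of the points presented so far into chains. In the up-growing variant, each newly presented point must be a maximal element of the order presented so far. The value of the game for up-growing semi-orders of width $w$ is the least integer $n$ such that Algorithm has a strategy using at most $n$ chains whenever the presented order is an up-growing semi-order of width at most $w$ (equivalently, the largest $n$ such that Spoiler can force $n$ chains on such orders). *)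

(* Defs.v *)
From Stdlib Require Import Reals Lra Lia Arith List.
Import ListNotations.
Open Scope R_scope.

(* A presented poset on the points 0, 1, ..., N-1, given by its strict order
   relation [lt] (only its values on points < N matter).  Point i is the i-th
   point presented by Spoiler. *)

Definition is_strict_order (N : nat) (lt : nat -> nat -> bool) : Prop :=
  (forall x, (x < N)%nat -> lt x x = false) /\
  (forall x y z, (x < N)%nat -> (y < N)%nat -> (z < N)%nat ->
     lt x y = true -> lt y z = true -> lt x z = true).

Definition comparable (lt : nat -> nat -> bool) (x y : nat) : Prop :=
  lt x y = true \/ lt y x = true.

Definition up_growing (N : nat) (lt : nat -> nat -> bool) : Prop :=
  forall i j, (j < i)%nat -> (i < N)%nat -> lt i j = false.

(* Semi-order: unit interval representation [I x, I x + 1]; x < y iff the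
   interval of x lies entirely to the left of the interval of y. *)
Definition semi_order (N : nat) (lt : nat -> nat -> bool) : Prop :=
  exists I : nat -> R, forall x y, (x < N)%nat -> (y < N)%nat ->
    (lt x y = true <-> I x + 1 < I y).

Definition antichain (N : nat) (lt : nat -> nat -> bool) (l : list nat) : Prop :=
  NoDup l /\ (forall x, In x l -> (x < N)%nat) /\
  (forall x y, In x l -> In y l -> x <> y -> ~ comparable lt x y).

Definition width_le (N : nat) (lt : nat -> nat -> bool) (w : nat) : Prop :=
  forall l, antichain N lt l -> (length l <= w)%nat.

Definition width_eq (N : nat) (lt : nat -> nat -> bool) (w : nat) : Prop :=
  width_le N lt w /\ exists l, antichain N lt l /\ length l = w.

Definition chain_partition (N : nat) (lt : nat -> nat -> bool) (c : nat -> nat) : Prop :=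
  forall x y, (x < N)%nat -> (y < N)%nat -> x <> y -> c x = c y -> comparable lt x y.

Definition num_chains (N : nat) (c : nat -> nat) : nat :=
  length (nodup Nat.eq_dec (map c (seq 0 N))).

(* An on-line (deterministic) algorithm: [alg n lt] is the chain assigned to
   point n; it may depend only on the comparabilities among points 0..n. *)
Definition online (alg : nat -> (nat -> nat -> bool) -> nat) : Prop :=
  forall n lt lt', (forall i j, (i <= n)%nat -> (j <= n)%nat -> lt i j = lt' i j) ->
    alg n lt = alg n lt'.

Definition phi : R := (1 + sqrt 5) / 2.

Definition floor_nat (r : R) : nat := Z.to_nat (Int_part r).

(* Main.v *)
(* Write b for the number of chains in excess of w. Since phi^2 = phi + 1, b <= (phi - 1) w means
   b^2 + w b <= w^2, and the map (a, b) -> (a - b, 2 b - a) preserves a^2 - a b - b^2; both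
   halves iterate this map, starting from a = w.

   Algorithm: place a new point on the chain with the rightmost top below it. Suppose the new
   point x lies above no top. Then the tops fill two unit windows around x, and counting the
   points in a window [s, s + 1] gives one inequality for each cut s. Starting at the leftmost
   top and always moving to the leftmost top that no point crossing the current cut covers,
   the inequalities at these cuts show that the excess b left to be accounted for evolves at
   best by (a, b) -> (a - b, 2 b - a). So a violation b^2 + a b > a^2 persists, which keeps b
   positive forever, but the tops are finitely many.

   Spoiler: after w minimal points (group 0), in round J present points above all groups
   0, ..., J. When such a point is placed on an element of a group l > 0, that element is declared
   the leftmost unused one of its twins, and the next point is presented above it and above
   everything to its left, but above no other unused element of its group; so the play descends
   until a new chain is opened or an element of group 0 is used. At the end of the round, group
   J + 1 consists of one point for each element of group 0 used in the round; its points lie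
   above the used elements of group 0 only, and all need new chains. With (a, b) at the
   beginning of the round, min(b, a - b) descents fit into width w. *)

Require Import Defs.
From Stdlib Require Import Reals Lra Lia Arith List Bool Classical ClassicalEpsilon.
Import ListNotations.
Open Scope nat_scope.

(** * Counting *)

(** Predicates are arbitrary propositions decided classically, so that sets cut out by inequalities
    between reals can be counted. *)
Fixpoint cnt (P : nat -> Prop) (n : nat) : nat :=
  match n with
  | O => O
  | S k => cnt P k + (if excluded_middle_informative (P k) then 1 else 0)
  end.

Lemma cnt_list (P : nat -> Prop) (n : nat) :
  exists l, NoDup l /\ (forall x, In x l <-> x < n /\ P x) /\ length l = cnt P n.
Proof.
  induction n as [|n [l [Hnd [Hin Hlen]]]].
  - exists []. split; [constructor|]. split; [|reflexivity].
    intro x; simpl; split; [tauto|lia].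
  - simpl. destruct (excluded_middle_informative (P n)) as [Hp|Hp].
    + exists (n :: l). split; [constructor; auto; rewrite Hin; lia|].
      split; [|simpl; lia]. intro x; simpl; rewrite Hin.
      split; [intros [<-|H]; split; try tauto; lia|].
      intros [H1 H2]. destruct (Nat.eq_dec n x); [tauto|right; split; [lia|tauto]].
    + exists l. split; [auto|]. split; [|lia]. intro x; rewrite Hin.
      split; [intros [H1 H2]; split; [lia|tauto]|].
      intros [H1 H2]. split; [|tauto]. destruct (Nat.eq_dec n x); [subst; tauto|lia].
Qed.

Lemma cnt_le (P Q : nat -> Prop) (n : nat) :
  (forall x, x < n -> P x -> Q x) -> cnt P n <= cnt Q n.
Proof.
  induction n as [|n IH]; intro H; simpl; [lia|].
  assert (cnt P n <= cnt Q n) by (apply IH; intros; apply H; auto with arith).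
  destruct (excluded_middle_informative (P n)) as [Hp|Hp];
    destruct (excluded_middle_informative (Q n)) as [Hq|Hq]; try lia.
  exfalso; apply Hq, H; auto.
Qed.

Lemma cnt_ext (P Q : nat -> Prop) (n : nat) :
  (forall x, x < n -> (P x <-> Q x)) -> cnt P n = cnt Q n.
Proof.
  intro H. apply Nat.le_antisymm; apply cnt_le; intros x Hx; apply (H x Hx).
Qed.

Lemma cnt_add (P Q R : nat -> Prop) (n : nat) :
  (forall x, x < n -> P x -> Q x -> False) ->
  (forall x, x < n -> P x \/ Q x -> R x) -> cnt P n + cnt Q n <= cnt R n.
Proof.
  induction n as [|n IH]; intros H1 H2; simpl; [lia|].
  assert (cnt P n + cnt Q n <= cnt R n) by (apply IH; intros x Hx; [apply (H1 x)|apply H2]; lia).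
  specialize (H1 n (Nat.lt_succ_diag_r n)). specialize (H2 n (Nat.lt_succ_diag_r n)).
  destruct (excluded_middle_informative (P n)); destruct (excluded_middle_informative (Q n));
    destruct (excluded_middle_informative (R n)); try lia; exfalso; tauto.
Qed.

Lemma cnt_cover (P Q R : nat -> Prop) (n : nat) :
  (forall x, x < n -> R x -> P x \/ Q x) -> cnt R n <= cnt P n + cnt Q n.
Proof.
  induction n as [|n IH]; intros H2; simpl; [lia|].
  assert (cnt R n <= cnt P n + cnt Q n) by (apply IH; intros; apply H2; auto with arith).
  specialize (H2 n (Nat.lt_succ_diag_r n)).
  destruct (excluded_middle_informative (P n)); destruct (excluded_middle_informative (Q n));
    destruct (excluded_middle_informative (R n)); try lia; exfalso; tauto.
Qed.

Lemma cnt_inj (f : nat -> nat) (P Q : nat -> Prop) (n m : nat) :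
  (forall x, x < n -> P x -> f x < m /\ Q (f x)) ->
  (forall x y, x < n -> y < n -> P x -> P y -> f x = f y -> x = y) ->
  cnt P n <= cnt Q m.
Proof.
  intros H1 H2.
  destruct (cnt_list P n) as [l [Hnd [Hin <-]]].
  destruct (cnt_list Q m) as [l' [Hnd' [Hin' <-]]].
  rewrite <- (length_map f l). apply NoDup_incl_length.
  - clear Hnd' Hin'. assert (Hl : forall x, In x l -> x < n /\ P x) by (intro; apply Hin).
    clear Hin. induction Hnd as [|a l Ha Hnd IH]; simpl; constructor.
    + rewrite in_map_iff. intros [b [Hb Hbl]].
      assert (b = a) by (apply H2; auto; try apply Hl; simpl; auto). subst; auto.
    + apply IH. intros; apply Hl; simpl; auto.
  - intros y Hy. apply in_map_iff in Hy as [x [<- Hx]]. apply Hin'. apply H1; apply Hin; auto.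
Qed.

Lemma cnt_none (P : nat -> Prop) (n : nat) : (forall x, x < n -> ~ P x) -> cnt P n = 0.
Proof.
  induction n as [|n IH]; intro H; simpl; [reflexivity|].
  rewrite IH by (intros; apply H; lia).
  destruct (excluded_middle_informative (P n)); [exfalso; eapply H; eauto|reflexivity].
Qed.

Lemma cnt_pos (P : nat -> Prop) (n x : nat) : x < n -> P x -> 0 < cnt P n.
Proof.
  induction n as [|n IH]; intros Hx Hp; [lia|]. simpl.
  destruct (Nat.eq_dec x n) as [->|].
  - destruct (excluded_middle_informative (P n)); [lia|tauto].
  - specialize (IH ltac:(lia) Hp). lia.
Qed.

Lemma cnt_bound (P : nat -> Prop) (n : nat) : cnt P n <= n.
Proof.
  induction n as [|n IH]; simpl; [lia|]. destruct (excluded_middle_informative (P n)); lia.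
Qed.

Lemma cnt_antichain (N n : nat) (lt : nat -> nat -> bool) (w : nat) (P : nat -> Prop) :
  width_le N lt w -> n <= N ->
  (forall x y, x < n -> y < n -> P x -> P y -> lt x y = true -> False) -> cnt P n <= w.
Proof.
  intros Hw Hn H. destruct (cnt_list P n) as [l [Hnd [Hin <-]]]. apply Hw.
  split; [auto|]. split; [intros x Hx; apply Hin in Hx; lia|].
  intros x y Hx Hy _ [Hc|Hc]; apply Hin in Hx; apply Hin in Hy; eapply H; [| | | |exact Hc| | | | |exact Hc]; tauto.
Qed.

(** * The golden ratio bound as an integer inequality *)

Lemma floor_nat_spec (r : R) (k : nat) : (0 <= r)%R -> (k <= floor_nat r <-> (INR k <= r)%R).
Proof.
  intro Hr. unfold floor_nat. destruct (base_Int_part r) as [H1 H2].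
  assert (Hz : (0 <= Int_part r)%Z).
  { assert (IZR (-1) < IZR (Int_part r))%R by (simpl; lra). apply lt_IZR in H. lia. }
  rewrite INR_IZR_INZ. split; intro H.
  - apply Rle_trans with (IZR (Int_part r)); [apply IZR_le; lia|lra].
  - assert (IZR (Z.of_nat k) < IZR (Int_part r + 1))%R by (rewrite plus_IZR; lra).
    apply lt_IZR in H0. lia.
Qed.

Lemma sqrt5_bounds : (sqrt 5 * sqrt 5 = 5 /\ 2 < sqrt 5 < 3)%R.
Proof.
  assert (H := sqrt_sqrt 5 ltac:(lra)). assert (H0 := sqrt_pos 5). repeat split; nra.
Qed.

(** The left side means [2 b + w <= sqrt 5 * w]; squaring these nonnegative quantities and dividing
    by 4 gives the right side. *)
Lemma phi_mul_spec (w b : nat) :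
  (INR (w + b) <= phi * INR w)%R <-> b * b + w * b <= w * w.
Proof.
  destruct sqrt5_bounds as [H5 H6].
  assert (E : (INR (b * b + w * b) = INR b * INR b + INR w * INR b)%R)
    by (rewrite plus_INR, !mult_INR; ring).
  assert (E' : (INR (w * w) = INR w * INR w)%R) by apply mult_INR.
  rewrite plus_INR. assert (Hw := pos_INR w). assert (Hb := pos_INR b).
  set (x := INR w) in *. set (y := INR b) in *. unfold phi.
  split; intro H.
  - apply INR_le. rewrite E, E'.
    assert (2 * y + x <= sqrt 5 * x)%R by lra. nra.
  - apply le_INR in H. rewrite E, E' in H.
    assert (2 * y + x <= sqrt 5 * x)%R; [|lra].
    apply Rsqr_incr_0_var; [unfold Rsqr; nra|nra].
Qed.

(** * A stuck best-fit algorithm *)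

Lemma finite_max (I : nat -> R) (P : nat -> Prop) (n : nat) :
  (exists x, x < n /\ P x) -> exists x, x < n /\ P x /\ forall y, y < n -> P y -> (I y <= I x)%R.
Proof.
  induction n as [|n IH]; intros [x [Hx Hp]]; [lia|].
  destruct (classic (exists x, x < n /\ P x)) as [H|H].
  - destruct (IH H) as [z [Hz [Hpz Hmax]]].
    destruct (classic (P n /\ (I z < I n)%R)) as [[Hn1 Hn2]|Hn].
    + exists n. repeat split; auto. intros y Hy Hpy.
      destruct (Nat.eq_dec y n) as [->|]; [lra|].
      assert (I y <= I z)%R by (apply Hmax; auto; lia). lra.
    + exists z. repeat split; auto. intros y Hy Hpy.
      destruct (Nat.eq_dec y n) as [->|]; [|apply Hmax; auto; lia].
      apply Rnot_lt_le. tauto.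
  - assert (x = n) as ->.
    { destruct (Nat.eq_dec x n); auto. exfalso; apply H; exists x; split; auto; lia. }
    exists n. repeat split; auto. intros y Hy Hpy.
    destruct (Nat.eq_dec y n) as [->|]; [lra|]. exfalso; apply H; exists y; split; auto; lia.
Qed.

Lemma finite_min (I : nat -> R) (P : nat -> Prop) (n : nat) :
  (exists x, x < n /\ P x) -> exists x, x < n /\ P x /\ forall y, y < n -> P y -> (I x <= I y)%R.
Proof.
  intro H. destruct (finite_max (fun x => - I x)%R P n H) as [x [H1 [H2 H3]]].
  exists x. repeat split; auto. intros y Hy Hp. specialize (H3 y Hy Hp). lra.
Qed.

(* [x] is a new point above no current top, [T] are the tops (including [x]), [l0] the leftmost of
   them; [t m] is the point on top of which [m] was placed (arbitrary if [m] opened a chain). *)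
Record stuck (M w : nat) (I : nat -> R) (T : nat -> Prop) (t : nat -> nat) (x l0 : nat) : Prop := {
  st_x : x < M /\ T x;
  st_l0 : l0 < M /\ T l0;
  st_min : forall y, y < M -> T y -> (I l0 <= I y)%R;
  st_max : forall y, y < M -> (I y <= I x + 1)%R;
  st_low : (I x <= I l0 + 1)%R;
  st_big : forall m, m < M -> (I l0 + 1 < I m)%R ->
    T m /\ t m < m /\ ~ T (t m) /\ (I (t m) + 1 < I m)%R;
  st_inj : forall m m', m < M -> m' < M -> (I l0 + 1 < I m)%R -> (I l0 + 1 < I m')%R ->
    t m = t m' -> m = m';
  st_idx : forall y m, y < M -> m < M -> (I y + 1 < I m)%R -> y < m;
  st_twin : forall m y, m < M -> y < M -> (I l0 + 1 < I m)%R -> T y -> (I y + 1 < I m)%R ->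
    (I (t m) < I y)%R -> forall z, z < m ->
    ((I z + 1 < I y)%R <-> (I z + 1 < I (t m))%R) /\ ((I y + 1 < I z)%R <-> (I (t m) + 1 < I z)%R);
  st_width : forall P : nat -> Prop,
    (forall a b, a < M -> b < M -> P a -> P b -> (I a + 1 < I b)%R -> False) -> cnt P M <= w
}.

(** Such an [m] skips [l]: it lies above [l] but was placed further left, so no covered point in the
    window starting at [l] pays for it. *)
Definition crosses (I : nat -> R) (t : nat -> nat) (l m : nat) : Prop :=
  (I l + 1 < I m)%R /\ (I (t m) < I l)%R.

(** A closed unit window is an antichain. Besides its tops it contains the non-top [t m] for every
    [m] counted in the second term, and [t] is injective on these. *)
Lemma window_bound (M w : nat) I T t x l0 (H : stuck M w I T t x l0) (s : R) :
  (I l0 <= s)%R ->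
  cnt (fun y => T y /\ s <= I y <= s + 1)%R M + cnt (fun m => s + 1 < I m /\ s <= I (t m))%R M <= w.
Proof.
  intro Hs.
  apply Nat.le_trans with (cnt (fun y => s <= I y <= s + 1)%R M).
  - apply Nat.le_trans with (cnt (fun y => T y /\ s <= I y <= s + 1)%R M
                             + cnt (fun y => ~ T y /\ s <= I y <= s + 1)%R M).
    + apply Nat.add_le_mono_l. apply cnt_inj with (f := t).
      * intros m Hm [H1 H2]. destruct (st_big _ _ _ _ _ _ _ H m Hm ltac:(lra)) as [_ [H3 [H4 H5]]].
        (* Here [I (t m) < I m - 1 <= I x <= I l0 + 1 <= s + 1], so [t m] is inside the window. *)
        split; [lia|]. split; [auto|]. assert (A := st_max _ _ _ _ _ _ _ H m Hm).
        assert (B := st_low _ _ _ _ _ _ _ H). lra.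
      * intros m m' Hm Hm' [H1 _] [H2 _]. apply (st_inj _ _ _ _ _ _ _ H); auto; lra.
    + apply cnt_add; tauto.
  - apply (st_width _ _ _ _ _ _ _ H). intros a b _ _ Ha Hb. lra.
Qed.

Lemma cut_bound (M w : nat) I T t x l0 (H : stuck M w I T t x l0) (s : R) :
  (I l0 <= s)%R ->
  cnt T M <= w + cnt (fun y => T y /\ I y < s)%R M + cnt (fun m => s + 1 < I m /\ I (t m) < s)%R M.
Proof.
  intro Hs. assert (W := window_bound _ _ _ _ _ _ _ H s Hs).
  assert (cnt T M <= cnt (fun y => T y /\ I y < s)%R M + cnt (fun y => T y /\ ~ I y < s)%R M)
    by (apply cnt_cover; intros; tauto).
  assert (cnt (fun y => T y /\ ~ I y < s)%R M
          <= cnt (fun y => T y /\ s <= I y <= s + 1)%R M + cnt (fun y => s + 1 < I y)%R M).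
  { apply cnt_cover. intros y _ [Hy1 Hy2]. destruct (Rlt_dec (s + 1) (I y)); [right; auto|left]. split; auto; lra. }
  assert (cnt (fun y => s + 1 < I y)%R M
     <= cnt (fun m => s + 1 < I m /\ s <= I (t m))%R M + cnt (fun m => s + 1 < I m /\ I (t m) < s)%R M).
  { apply cnt_cover. intros y _ Hy. destruct (Rlt_dec (I (t y)) s); [right|left]; split; auto; lra. }
  lia.
Qed.

(** This passes from the crossings of [l] to those of [l'], counting only the points presented after
    time [tau]. The window is cut at an [s] between the two, and the points between [l] and [l'] are
    charged from both sides of [s]. *)
Lemma shift_bound (M w : nat) I T t x l0 (H : stuck M w I T t x l0) (l l' tau : nat) :
  l < M -> l' < M -> T l -> T l' -> (I l <= I l')%R ->
  (forall m, m < M -> crosses I t l m -> (I m <= I l' + 1)%R) ->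
  cnt T M + cnt (fun m => crosses I t l' m /\ tau < m) M
  <= w + cnt (fun y => T y /\ I y < I l)%R M + cnt (fun m => crosses I t l m /\ tau < m) M
     + cnt (fun z => I l <= I z < I l')%R M.
Proof.
  intros Hl Hl' Tl Tl' Hll Hnot.
  assert (H0 := st_min _ _ _ _ _ _ _ H l Hl Tl).
  assert (Hx := st_low _ _ _ _ _ _ _ H).
  assert (Hs : exists s, (I l <= s <= I l')%R /\
     (forall m, m < M -> crosses I t l m -> m <= tau -> (I m <= s + 1)%R) /\
     (s = I l \/ exists m, m < M /\ crosses I t l m /\ m <= tau /\ s = (I m - 1)%R)).
  { destruct (classic (exists m, m < M /\ (crosses I t l m /\ m <= tau))) as [Hex|Hex].
    - destruct (finite_max I _ M Hex) as [m [Hm [[Hv Ht] Hmax]]].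
      exists (I m - 1)%R. split; [destruct Hv; specialize (Hnot m Hm ltac:(split; auto)); lra|].
      split; [intros m' Hm' Hv' Ht'; specialize (Hmax m' Hm' (conj Hv' Ht')); lra|].
      right. exists m. auto.
    - exists (I l). split; [lra|]. split; [|auto].
      intros m Hm Hv Ht. exfalso; apply Hex; exists m; auto. }
  destruct Hs as [s [Hs1 [Hs2 Hs3]]].
  (* elements crossing [l'] presented after [tau] used a point right of the cut [s] *)
  assert (Key : forall m, m < M -> crosses I t l' m -> tau < m -> (s <= I (t m) < I l')%R).
  { intros m Hm [Hv1 Hv2] Ht. split; [|auto].
    assert (I l <= I (t m))%R.
    { apply Rnot_lt_le. intro C. assert (crosses I t l m) by (split; lra). specialize (Hnot m Hm H1). lra. }
    destruct Hs3 as [->|[m0 [Hm0 [Hv0 [Ht0 ->]]]]]; [auto|].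
    (* Otherwise [m0], presented before [m], is above [t m] but not above [l'], although [m] was
       placed on [t m] with the top [l'] available further right. *)
    apply Rnot_lt_le. intro C.
    assert (E := st_twin _ _ _ _ _ _ _ H m l' Hm Hl' ltac:(lra) Tl' Hv1 Hv2 m0 ltac:(lia)).
    assert (I l' + 1 < I m0)%R by (apply E; lra).
    specialize (Hnot m0 Hm0 Hv0). lra. }
  assert (W := window_bound _ _ _ _ _ _ _ H s ltac:(lra)).
  assert (A1 : cnt T M <= cnt (fun y => T y /\ I y < I l)%R M + cnt (fun y => T y /\ ~ I y < I l)%R M)
    by (apply cnt_cover; intros; tauto).
  assert (A2 : cnt (fun y => T y /\ ~ I y < I l)%R M <=
     cnt (fun y => T y /\ I l <= I y < s)%R M + cnt (fun y => T y /\ s <= I y)%R M).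
  { apply cnt_cover. intros y _ [Hy1 Hy2]. destruct (Rlt_dec (I y) s); [left|right]; repeat split; auto; lra. }
  assert (A3 : cnt (fun y => T y /\ s <= I y)%R M
          <= cnt (fun y => T y /\ s <= I y <= s + 1)%R M + cnt (fun y => s + 1 < I y)%R M).
  { apply cnt_cover. intros y _ [Hy1 Hy2]. destruct (Rlt_dec (s + 1) (I y)); [right; auto|left]. split; auto; lra. }
  assert (A4 : cnt (fun y => s + 1 < I y)%R M
     <= cnt (fun m => s + 1 < I m /\ s <= I (t m))%R M + cnt (fun m => s + 1 < I m /\ I (t m) < s)%R M).
  { apply cnt_cover. intros y _ Hy. destruct (Rlt_dec (I (t y)) s); [right|left]; split; auto; lra. }
  assert (A5 : cnt (fun m => s + 1 < I m /\ I (t m) < s)%R M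
     <= cnt (fun m => crosses I t l m /\ tau < m) M + cnt (fun m => s + 1 < I m /\ I l <= I (t m) < s)%R M).
  { apply cnt_cover. intros m Hm [Hy1 Hy2]. destruct (Rlt_dec (I (t m)) (I l)) as [Hd|Hd]; [left|right].
    - assert (Hv : crosses I t l m) by (split; lra). split; [auto|].
      apply Nat.nle_gt. intro C. specialize (Hs2 m Hm Hv C). lra.
    - split; auto; lra. }
  assert (A6 : cnt (fun m => s + 1 < I m /\ I l <= I (t m) < s)%R M
     <= cnt (fun z => ~ T z /\ I l <= I z < s)%R M).
  { apply cnt_inj with (f := t).
    - intros m Hm [H1 H2]. destruct (st_big _ _ _ _ _ _ _ H m Hm ltac:(lra)) as [_ [H3 [H4 H5]]].
      split; [lia|]. auto.
    - intros m m' Hm Hm' [H1 _] [H2 _]. apply (st_inj _ _ _ _ _ _ _ H); auto; lra. }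
  assert (A7 : cnt (fun m => crosses I t l' m /\ tau < m) M <= cnt (fun z => s <= I z < I l')%R M).
  { apply cnt_inj with (f := t).
    - intros m Hm [H1 H2]. destruct (st_big _ _ _ _ _ _ _ H m Hm) as [_ [H3 [H4 H5]]].
      { destruct H1; lra. } split; [lia|]. apply Key; auto.
    - intros m m' Hm Hm' [[H1 _] _] [[H2 _] _]. apply (st_inj _ _ _ _ _ _ _ H); auto; lra. }
  assert (A8 : cnt (fun z => ~ T z /\ I l <= I z < s)%R M + cnt (fun y => T y /\ I l <= I y < s)%R M
      <= cnt (fun z => I l <= I z < s)%R M) by (apply cnt_add; tauto).
  assert (A9 : cnt (fun z => I l <= I z < s)%R M + cnt (fun z => s <= I z < I l')%R M
      <= cnt (fun z => I l <= I z < I l')%R M) by (apply cnt_add; intros; lra).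
  lia.
Qed.

(** The three sets form one antichain, the last represented by the points [t m]. As [t m] and [l0]
    are twins when [m] arrives, [l] is not above [t m]; the tops between [l] and [l'] inherit this
    because they are twins of [l] when [e] arrives. *)
Lemma group_bound (M w : nat) I T t x l0 (H : stuck M w I T t x l0) (l l' e : nat) :
  l < M -> l' < M -> e < M -> T l -> T l' -> (I l <= I x)%R -> (I l <= I l' <= I x)%R ->
  crosses I t l e -> (forall y, y < M -> T y -> (I y < I l')%R -> (I y + 1 < I e)%R) ->
  cnt (fun z => I l0 <= I z < I l)%R M + cnt (fun y => T y /\ I l <= I y < I l')%R M
    + cnt (fun m => crosses I t l0 m /\ l < m) M <= w.
Proof.
  intros Hl Hl' He Tl Tl' Hlx Hll' Ve Hcov.
  assert (H0 := st_min _ _ _ _ _ _ _ H l Hl Tl).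
  assert (Hx := st_low _ _ _ _ _ _ _ H).
  destruct (st_l0 _ _ _ _ _ _ _ H) as [Hl0 Tl0].
  set (Q1 := fun z => (I l0 <= I z < I l)%R).
  set (Q2 := fun y => T y /\ (I l <= I y < I l')%R).
  set (Q3 := fun z => (I z < I l0)%R /\ exists m, m < M /\ crosses I t l0 m /\ l < m /\ z = t m).
  assert (cnt (fun m => crosses I t l0 m /\ l < m) M <= cnt Q3 M).
  { apply cnt_inj with (f := t).
    - intros m Hm [[H1 H2] H3]. destruct (st_big _ _ _ _ _ _ _ H m Hm H1) as [_ [H4 _]].
      split; [lia|]. split; [auto|]. exists m. repeat split; auto.
    - intros m m' Hm Hm' [[H1 _] _] [[H2 _] _]. apply (st_inj _ _ _ _ _ _ _ H); auto; lra. }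
  assert (cnt Q1 M + cnt Q2 M <= cnt (fun z => Q1 z \/ Q2 z) M)
    by (apply cnt_add; [unfold Q1, Q2; intros; lra|tauto]).
  assert (cnt (fun z => Q1 z \/ Q2 z) M + cnt Q3 M <= cnt (fun z => (Q1 z \/ Q2 z) \/ Q3 z) M)
    by (apply cnt_add; [unfold Q1, Q2, Q3; intros; lra|tauto]).
  assert (cnt (fun z => (Q1 z \/ Q2 z) \/ Q3 z) M <= w); [|lia].
  apply (st_width _ _ _ _ _ _ _ H). intros a b Ha Hb Qa Qb Hab.
  assert (Hb' : (I b < I l')%R) by (unfold Q1, Q2, Q3 in Qb; lra).
  destruct Qa as [Qa|[Qa [m [Hm [[Hv1 Hv2] [Hlm ->]]]]]].
  { unfold Q1, Q2 in Qa. lra. }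
  assert (E : ~ (I (t m) + 1 < I l)%R).
  { intro C. apply (st_twin _ _ _ _ _ _ _ H m l0 Hm Hl0 Hv1 Tl0 Hv1 Hv2 l Hlm) in C. lra. }
  destruct (Rle_dec (I b) (I l)) as [Hbl|Hbl]; [lra|].
  destruct Qb as [[Qb|[Tb Qb]]|[Qb _]]; [unfold Q1 in Qb; lra| |lra].
  (* [b] and [l] are both tops below [e], hence twins of [t e], so they have the same predecessors *)
  destruct Ve as [Ve1 Ve2].
  assert (Hbe := Hcov b Hb Tb Hb').
  assert (Hbi := st_idx _ _ _ _ _ _ _ H (t m) b Ha Hb Hab).
  assert (Hei := st_idx _ _ _ _ _ _ _ H b e Hb He Hbe).
  assert (E1 := st_twin _ _ _ _ _ _ _ H e b He Hb ltac:(lra) Tb Hbe ltac:(lra) (t m) ltac:(lia)).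
  assert (E2 := st_twin _ _ _ _ _ _ _ H e l He Hl ltac:(lra) Tl Ve1 Ve2 (t m) ltac:(lia)).
  tauto.
Qed.

(** For [X = a - beta] the new pair is [(a - beta, 2 beta - a)], on which the quadratic form has the
    same value; a smaller [X] only enlarges the second entry and hence the violation. *)
Lemma golden_step (a beta X : Z) :
  (0 <= X -> 0 < beta -> X + beta <= a -> a * a < beta * beta + a * beta ->
   0 < beta - X /\ (a - beta) * (a - beta)
     < (beta - X) * (beta - X) + (a - beta) * (beta - X))%Z.
Proof.
  intros H0 H1 H3 H4.
  assert (H5 : (0 < 2 * beta - a)%Z) by nia.
  split; [lia|].
  assert (H6 : ((2 * beta - a) * (2 * beta - a) <= (beta - X) * (beta - X))%Z) by nia.
  assert (H7 : ((a - beta) * (2 * beta - a) <= (a - beta) * (beta - X))%Z) by nia.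
  nia.
Qed.

(* The pair (a, beta) moves to (a - beta, 2 beta - a) or better; this step preserves the
   value of beta^2 + a beta - a^2, so beta never becomes non-positive. *)
Lemma stuck_descent (M w : nat) I T t x l0 (H : stuck M w I T t x l0) (b : nat) (k : nat) :
  cnt T M = w + b ->
  forall (l : nat) (q a beta : Z),
  l < M -> T l -> (I l <= I x)%R ->
  cnt (fun y => T y /\ I l <= I y)%R M <= k ->
  (forall tau : nat, (q + Z.of_nat (cnt (fun m => crosses I t l m /\ (tau < m)%nat) M)
     <= Z.of_nat (cnt (fun m => crosses I t l0 m /\ (tau < m)%nat) M + cnt (fun z => I l0 <= I z < I l)%R M))%Z) ->
  a = (Z.of_nat w - q)%Z ->
  beta = (Z.of_nat b - Z.of_nat (cnt (fun y => T y /\ I y < I l)%R M))%Z ->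
  (0 < beta)%Z -> (0 <= a)%Z -> (a * a < beta * beta + a * beta)%Z -> False.
Proof.
  (* [k] bounds the number of tops from [l] rightwards. [q = w - a] is the sum of the earlier values
     of [beta]. The invariant is kept for all times [tau], since each step uses it at [tau = l] for
     a different [l]. *)
  intro HS. induction k as [|k IH]; intros l q a beta Hl Tl Hlx Hk Hinv Ha Hbeta Hpos Ha0 HQ.
  { assert (0 < cnt (fun y => T y /\ I l <= I y)%R M) by (apply cnt_pos with l; auto; split; auto; lra). lia. }
  assert (H0 := st_min _ _ _ _ _ _ _ H l Hl Tl).
  assert (Hx := st_low _ _ _ _ _ _ _ H).
  destruct (st_x _ _ _ _ _ _ _ H) as [HxM Tx].
  assert (Cut := cut_bound _ _ _ _ _ _ _ H (I l) H0).
  destruct (classic (exists m, m < M /\ crosses I t l m)) as [Hex|Hex].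
  (* Without crossings the cut at [l] leaves no excess, against [0 < beta]. *)
  2: { rewrite (cnt_none (fun m => (I l + 1 < I m)%R /\ (I (t m) < I l)%R)) in Cut; [lia|].
       intros m Hm Hv. apply Hex. exists m. split; auto. }
  (* [e] is the rightmost point crossing [l], and [l'] below will be the leftmost top that [e] is
     not above. *)
  destruct (finite_max I _ M Hex) as [e [He [Ve Hmax]]].
  assert (Hex' : exists y, y < M /\ (T y /\ (I e - 1 <= I y)%R)).
  { exists x. split; [auto|]. split; [auto|]. assert (A := st_max _ _ _ _ _ _ _ H e He). lra. }
  destruct (finite_min I _ M Hex') as [l' [Hl' [[Tl' Hle] Hmin]]].
  assert (Hl'x : (I l' <= I x)%R).
  { apply Hmin; auto. split; auto. assert (A := st_max _ _ _ _ _ _ _ H e He). lra. }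
  assert (Hll' : (I l < I l')%R) by (destruct Ve; lra).
  assert (Hnot : forall m, m < M -> crosses I t l m -> (I m <= I l' + 1)%R).
  { intros m Hm Hv. specialize (Hmax m Hm Hv). lra. }
  assert (G := group_bound _ _ _ _ _ _ _ H l l' e Hl Hl' He Tl Tl' Hlx ltac:(lra) Ve).
  assert (G' : forall y, y < M -> T y -> (I y < I l')%R -> (I y + 1 < I e)%R).
  { intros y Hy Ty Hyl. apply Rnot_le_lt. intro C.
    assert (I l' <= I y)%R by (apply Hmin; auto; split; auto; lra). lra. }
  specialize (G G').
  assert (Hv : cnt (fun m => (I l + 1 < I m)%R /\ (I (t m) < I l)%R) M
               = cnt (fun m => crosses I t l m /\ l < m) M).
  { apply cnt_ext. intros m Hm. unfold crosses. split; [|tauto]. intros [h1 h2].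
    repeat split; auto. apply (st_idx _ _ _ _ _ _ _ H); auto. }
  assert (Hinvl := Hinv l).
  set (X := cnt (fun y => T y /\ (I l <= I y < I l')%R) M) in *.
  assert (HP : cnt (fun y => T y /\ I y < I l')%R M = cnt (fun y => T y /\ I y < I l)%R M + X).
  { apply Nat.le_antisymm.
    - apply cnt_cover. intros y _ [h1 h2]. destruct (Rlt_dec (I y) (I l)); [left|right]; repeat split; auto; lra.
    - apply cnt_add; [intros; lra|]. intros y _ [[h1 h2]|[h1 h2]]; split; auto; lra. }
  assert (Hrest : cnt (fun y => T y /\ I l' <= I y)%R M < cnt (fun y => T y /\ I l <= I y)%R M).
  { assert (cnt (fun y => T y /\ I l' <= I y)%R M + cnt (fun y => y = l) M
            <= cnt (fun y => T y /\ I l <= I y)%R M).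
    { apply cnt_add; [intros y _ [h1 h2] ->; lra|]. intros y _ [[h1 h2]| ->]; split; auto; lra. }
    assert (0 < cnt (fun y => y = l) M) by (apply cnt_pos with l; auto). lia. }
  (* The cut at [l] gives at least [beta] crossings of [l], all later than [l]. The invariant at
     [tau = l] and the bound [G] then give [q + beta + X <= w]. *)
  assert (HX : (Z.of_nat X + beta <= a)%Z) by lia.
  destruct (golden_step a beta (Z.of_nat X)) as [Hg1 Hg2]; auto; try lia.
  apply (IH l' (q + beta)%Z (a - beta)%Z (beta - Z.of_nat X)%Z); auto; try lia.
  intro tau. assert (Sh := shift_bound _ _ _ _ _ _ _ H l l' tau Hl Hl' Tl Tl' ltac:(lra) Hnot).
  assert (HF : cnt (fun z => I l0 <= I z < I l)%R M + cnt (fun z => I l <= I z < I l')%R M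
     <= cnt (fun z => I l0 <= I z < I l')%R M) by (apply cnt_add; intros; lra).
  specialize (Hinv tau). lia.
Qed.

Lemma stuck_bound (M w : nat) I T t x l0 (H : stuck M w I T t x l0) (b : nat) :
  cnt T M = w + b -> b * b + w * b <= w * w.
Proof.
  intro HS. apply Nat.nlt_ge. intro C.
  destruct (st_l0 _ _ _ _ _ _ _ H) as [Hl0 Tl0]. destruct (st_x _ _ _ _ _ _ _ H) as [HxM Tx].
  assert (E : cnt (fun y => T y /\ I y < I l0)%R M = 0).
  { apply cnt_none. intros y Hy [h1 h2]. assert (A := st_min _ _ _ _ _ _ _ H y Hy h1). lra. }
  apply (stuck_descent _ _ _ _ _ _ _ H b _ HS l0 0%Z (Z.of_nat w) (Z.of_nat b) Hl0 Tl0
    (st_min _ _ _ _ _ _ _ H x HxM Tx) (Nat.le_refl _)); try lia.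
Qed.

(** * The best-fit algorithm *)

Definition topb (c : nat -> nat) (n y : nat) : bool :=
  forallb (fun z => negb (c z =? c y)) (seq (S y) (n - S y)).

Definition top (c : nat -> nat) (n y : nat) : Prop :=
  forall z, y < z -> z < n -> c z <> c y.

(** Algorithm sees no coordinates. In every unit representation this count does not decrease to the
    right, so maximizing it finds the rightmost top up to points not yet distinguished. *)
Definition score (lt : nat -> nat -> bool) (n y : nat) : nat :=
  length (filter (fun z => lt z y) (seq 0 n)) + length (filter (fun z => negb (lt y z)) (seq 0 n)).

Definition argmax (f : nat -> nat) (l : list nat) : option nat :=
  fold_right (fun y o => match o with
                         | None => Some y
                         | Some z => if f z <? f y then Some y else Some z
                         end) None l.

Definition pick (lt : nat -> nat -> bool) (c : nat -> nat) (n : nat) : option nat :=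
  argmax (score lt n) (filter (fun y => lt y n && topb c n y) (seq 0 n)).

(** A new chain is named by the index of its first point. The name is fresh because no point is on a
    chain with a name above its own index. *)
Fixpoint best_fit_upto (lt : nat -> nat -> bool) (k : nat) : nat -> nat :=
  match k with
  | O => fun _ => O
  | S n => let c := best_fit_upto lt n in
           fun i => if i =? n then match pick lt c n with None => n | Some y => c y end
                    else c i
  end.

Definition best_fit (n : nat) (lt : nat -> nat -> bool) : nat := best_fit_upto lt (S n) n.

Lemma topb_spec c n y : topb c n y = true <-> top c n y.
Proof.
  unfold topb, top. rewrite forallb_forall. split.
  - intros H z Hyz Hzn E. specialize (H z). rewrite E, Nat.eqb_refl in H.
    discriminate H. apply in_seq. lia.
  - intros H z Hz. apply in_seq in Hz. apply negb_true_iff, Nat.eqb_neq, H; lia.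
Qed.

Lemma argmax_spec f l :
  match argmax f l with
  | None => l = []
  | Some y => In y l /\ forall z, In z l -> f z <= f y
  end.
Proof.
  induction l as [|a l IH]; simpl; [reflexivity|].
  destruct (argmax f l) as [y|].
  - destruct IH as [H1 H2]. destruct (Nat.ltb_spec (f y) (f a)).
    + split; [auto|]. intros z [<-|Hz]; [lia|]. specialize (H2 z Hz). lia.
    + split; [auto|]. intros z [<-|Hz]; [lia|auto].
  - subst. split; [auto|]. intros z [<-|[]]; lia.
Qed.

Lemma pick_spec lt c n :
  match pick lt c n with
  | None => forall y, y < n -> lt y n = true -> top c n y -> False
  | Some y => y < n /\ lt y n = true /\ top c n y /\
      forall z, z < n -> lt z n = true -> top c n z -> score lt n z <= score lt n y
  end.
Proof.
  unfold pick. set (l := filter _ _).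
  assert (Hl : forall z, In z l <-> z < n /\ lt z n = true /\ top c n z).
  { intro z. unfold l. rewrite filter_In, in_seq, andb_true_iff, topb_spec. intuition lia. }
  assert (A := argmax_spec (score lt n) l). destruct (argmax (score lt n) l) as [y|].
  - destruct A as [A B]. apply Hl in A. repeat split; try tauto. intros z h1 h2 h3. apply B, Hl. auto.
  - intros y h1 h2 h3. assert (In y l) by (apply Hl; auto). rewrite A in H. destruct H.
Qed.

Lemma best_fit_upto_eq lt k i : i < k -> best_fit_upto lt k i = best_fit i lt.
Proof.
  induction k as [|k IH]; intro H; [lia|].
  destruct (Nat.eq_dec i k) as [->|]; [reflexivity|].
  simpl. destruct (Nat.eqb_spec i k); [lia|]. apply IH. lia.
Qed.

Lemma pick_ext lt lt' c c' n :
  (forall i j, i <= n -> j <= n -> lt i j = lt' i j) -> (forall i, i < n -> c i = c' i) ->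
  pick lt c n = pick lt' c' n.
Proof.
  intros H1 H2. unfold pick.
  assert (E : filter (fun y => lt y n && topb c n y) (seq 0 n)
            = filter (fun y => lt' y n && topb c' n y) (seq 0 n)).
  { apply filter_ext_in. intros y Hy. apply in_seq in Hy. rewrite H1 by lia. f_equal.
    apply eq_true_iff_eq. rewrite !topb_spec. unfold top.
    split; intros H z h1 h2; specialize (H z h1 h2); rewrite !H2 in * by lia; auto. }
  rewrite E. clear E.
  assert (Hl : forall y, In y (filter (fun y => lt' y n && topb c' n y) (seq 0 n)) -> y < n).
  { intros y Hy. apply filter_In in Hy. destruct Hy as [Hy _]. apply in_seq in Hy. lia. }
  induction (filter (fun y => lt' y n && topb c' n y) (seq 0 n)) as [|a l IH]; [reflexivity|].
  assert (Es : forall y, y < n -> score lt n y = score lt' n y).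
  { intros y Hy. unfold score. f_equal; f_equal; apply filter_ext_in;
      intros z Hz; apply in_seq in Hz; rewrite H1 by lia; reflexivity. }
  simpl. rewrite IH by (intros; apply Hl; simpl; auto).
  assert (A := argmax_spec (score lt' n) l). destruct (argmax (score lt' n) l) as [y|]; [|reflexivity].
  rewrite !Es; [reflexivity| |]; apply Hl; simpl; tauto.
Qed.

Lemma best_fit_eq lt n :
  best_fit n lt = match pick lt (fun i => best_fit i lt) n with
                  | None => n | Some y => best_fit y lt end.
Proof.
  unfold best_fit at 1. simpl. rewrite Nat.eqb_refl.
  rewrite (pick_ext lt lt (best_fit_upto lt n) (fun i => best_fit i lt) n);
    [|reflexivity|intros; apply best_fit_upto_eq; auto].
  assert (A := pick_spec lt (fun i => best_fit i lt) n).
  destruct (pick lt (fun i => best_fit i lt) n); [|reflexivity].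
  apply best_fit_upto_eq. tauto.
Qed.

Lemma best_fit_online : online best_fit.
Proof.
  intro n. induction n as [n IH] using (well_founded_induction lt_wf). intros lt lt' H.
  rewrite (best_fit_eq lt), (best_fit_eq lt').
  rewrite (pick_ext lt lt' (fun i => best_fit i lt) (fun i => best_fit i lt') n); auto.
  2: { intros i Hi. apply IH; auto. intros; apply H; lia. }
  assert (A := pick_spec lt' (fun i => best_fit i lt') n).
  destruct (pick lt' (fun i => best_fit i lt') n) as [y|]; [|reflexivity].
  apply IH; [tauto|]. intros; apply H; lia.
Qed.

Lemma best_fit_le lt n : best_fit n lt <= n.
Proof.
  induction n as [n IH] using (well_founded_induction lt_wf). rewrite best_fit_eq.
  assert (A := pick_spec lt (fun i => best_fit i lt) n).
  destruct (pick lt (fun i => best_fit i lt) n) as [y|]; [|lia].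
  specialize (IH y ltac:(tauto)). lia.
Qed.

(** A reused chain receives the new point above its top [z], and by induction [z] is above the rest
    of the chain. *)
Lemma best_fit_chains N lt : is_strict_order N lt ->
  chain_partition N lt (fun i => best_fit i lt).
Proof.
  intros [Hirr Htr].
  assert (A : forall n, n < N -> forall y, y < n -> best_fit y lt = best_fit n lt -> lt y n = true).
  { intro n. induction n as [n IH] using (well_founded_induction lt_wf). intros Hn y Hy E.
    rewrite (best_fit_eq lt n) in E.
    assert (A := pick_spec lt (fun i => best_fit i lt) n).
    destruct (pick lt (fun i => best_fit i lt) n) as [z|].
    - destruct A as [A1 [A2 [A3 _]]]. destruct (lt_eq_lt_dec y z) as [[C| ->]|C]; auto.
      + apply Htr with z; try lia; auto. apply IH; [lia|lia|lia|exact E].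
      + exfalso. apply (A3 y C Hy E).
    - assert (B := best_fit_le lt y). lia. }
  intros x y Hx Hy Hne E. destruct (lt_eq_lt_dec x y) as [[C|C]|C]; [left|tauto|right]; apply A; auto.
Qed.

Lemma filter_length_eq (f g : nat -> bool) (l : list nat) :
  (forall z, In z l -> f z = true -> g z = true) ->
  length (filter g l) <= length (filter f l) -> forall z, In z l -> f z = g z.
Proof.
  induction l as [|a l IH]; intros H1 H2 z Hz; [destruct Hz|].
  assert (H3 : length (filter f l) <= length (filter g l)).
  { clear IH H2 Hz. assert (H1' : forall z, In z l -> f z = true -> g z = true) by (intros; apply H1; simpl; auto).
    clear H1. induction l as [|c l IH]; simpl; [lia|].
    assert (Hc := H1' c ltac:(simpl; auto)). assert (length (filter f l) <= length (filter g l)).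
    { apply IH. intros; apply H1'; simpl; auto. }
    destruct (f c); destruct (g c); simpl; try lia; discriminate (Hc eq_refl). }
  assert (Ha := H1 a ltac:(simpl; auto)). simpl in H2.
  destruct (f a) eqn:Ef; destruct (g a) eqn:Eg; simpl in H2; try lia;
    try (specialize (Ha eq_refl); discriminate).
  - destruct Hz as [<-|Hz]; [congruence|]. apply IH; auto; [intros; apply H1; simpl; auto|lia].
  - destruct Hz as [<-|Hz]; [congruence|]. apply IH; auto. intros; apply H1; simpl; auto.
Qed.

(* Raising a point can only enlarge its down-set and shrink its up-set, so among two points
   of equal score both sets agree. *)
Lemma score_twins lt n y t :
  (forall z, z < n -> lt z t = true -> lt z y = true) ->
  (forall z, z < n -> lt y z = true -> lt t z = true) ->
  score lt n y <= score lt n t ->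
  forall z, z < n -> lt z y = lt z t /\ lt y z = lt t z.
Proof.
  intros H1 H2 H3 z Hz. unfold score in H3.
  assert (Hin : In z (seq 0 n)) by (apply in_seq; lia).
  assert (L1 : forall f g : nat -> bool, (forall z, z < n -> f z = true -> g z = true) ->
     length (filter f (seq 0 n)) <= length (filter g (seq 0 n))).
  { intros f g Hfg. apply NoDup_incl_length; [apply NoDup_filter, seq_NoDup|].
    intros u Hu. apply filter_In in Hu. apply filter_In. destruct Hu as [Hu Hf].
    split; auto. apply Hfg; auto. apply in_seq in Hu. lia. }
  assert (E1 := L1 (fun z => lt z t) (fun z => lt z y) H1).
  assert (H2' : forall z, z < n -> negb (lt t z) = true -> negb (lt y z) = true).
  { intros u Hu Hn. apply negb_true_iff in Hn. apply negb_true_iff.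
    specialize (H2 u Hu). destruct (lt y u); auto. rewrite H2 in Hn; auto. }
  assert (E2 := L1 (fun z => negb (lt t z)) (fun z => negb (lt y z)) H2').
  split.
  - symmetry. apply (filter_length_eq (fun z => lt z t) (fun z => lt z y) (seq 0 n)); auto; [|lia].
    intros u Hu. apply in_seq in Hu. apply H1. lia.
  - assert (negb (lt t z) = negb (lt y z)).
    { apply (filter_length_eq (fun z => negb (lt t z)) (fun z => negb (lt y z)) (seq 0 n)); auto; [|lia].
      intros u Hu. apply in_seq in Hu. apply H2'. lia. }
    destruct (lt t z), (lt y z); simpl in *; congruence.
Qed.

Lemma num_chains_le (c : nat -> nat) (k : nat) (l : list nat) :
  (forall x, x < k -> In (c x) l) -> num_chains k c <= length l.
Proof.
  intro H. unfold num_chains. apply NoDup_incl_length; [apply NoDup_nodup|].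
  intros y Hy. apply nodup_In in Hy. apply in_map_iff in Hy as [x [<- Hx]].
  apply H. apply in_seq in Hx. lia.
Qed.

Lemma num_chains_in (c : nat -> nat) (k x : nat) :
  x < k -> In (c x) (nodup Nat.eq_dec (map c (seq 0 k))).
Proof.
  intro Hx. apply nodup_In, in_map, in_seq. lia.
Qed.

Lemma num_chains_tops (c : nat -> nat) (k : nat) : num_chains k c <= cnt (top c k) k.
Proof.
  destruct (cnt_list (top c k) k) as [l [_ [Hin <-]]]. rewrite <- (length_map c l).
  apply num_chains_le. intros x Hx.
  (* With [INR] as coordinate this yields the last point on the chain of [x]. *)
  destruct (finite_max INR (fun y => c y = c x) k) as [y [Hy [E Hmax]]]; [exists x; auto|].
  rewrite <- E. apply in_map, Hin. split; [auto|]. intros z h1 h2 h3.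
  assert (A := Hmax z h2 ltac:(congruence)). apply INR_le in A. lia.
Qed.

Definition pred_of (lt : nat -> nat -> bool) (m : nat) : nat :=
  match pick lt (fun i => best_fit i lt) m with Some y => y | None => 0 end.

(** A current top was a top ever since it was presented. So a point above [l0] could not open a
    chain, and the one it chose scored at least as high as every current top below it. *)
Lemma best_fit_stuck (N w : nat) (lt : nat -> nat -> bool) (I : nat -> R) (n : nat) :
  is_strict_order N lt -> up_growing N lt -> width_le N lt w ->
  (forall x y, x < N -> y < N -> (lt x y = true <-> (I x + 1 < I y)%R)) ->
  n < N -> pick lt (fun i => best_fit i lt) n = None ->
  exists l0, stuck (S n) w I (top (fun i => best_fit i lt) (S n)) (pred_of lt) n l0.
Proof.
  intros Hso Hup Hw HI Hn Hnone.
  set (c := fun i => best_fit i lt) in *. set (T := top c (S n)).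
  assert (Hch := best_fit_chains N lt Hso).
  assert (Hidx : forall x y, x < S n -> y < S n -> (I x + 1 < I y)%R -> x < y).
  { intros x y Hx Hy H. apply HI in H; try lia. destruct (lt_eq_lt_dec x y) as [[C|C]|C]; auto.
    - subst. destruct Hso as [Hirr _]. rewrite Hirr in H by lia. discriminate.
    - rewrite Hup in H by lia. discriminate. }
  assert (Tn : T n) by (intros z h1 h2; lia).
  assert (Ttop : forall m y, m < S n -> T y -> top c m y).
  { intros m y Hm HT z h1 h2. apply HT; lia. }
  assert (Hmax : forall y, y < S n -> (I y <= I n + 1)%R).
  { intros y Hy. apply Rnot_lt_le. intro C. apply Hidx in C; lia. }
  assert (Hlow : forall y, y < S n -> T y -> (I n <= I y + 1)%R).
  { intros y Hy HT. apply Rnot_lt_le. intro C. assert (A := pick_spec lt c n). rewrite Hnone in A.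
    assert (y < n) by (apply Hidx; auto). apply (A y); auto. apply HI; auto; lia. }
  destruct (finite_min I T (S n)) as [l0 [Hl0 [Tl0 Hmin]]]; [exists n; auto|].
  assert (Hbig : forall m, m < S n -> (I l0 + 1 < I m)%R -> exists y, pick lt c m = Some y /\
     y < m /\ lt y m = true /\ top c m y /\ c m = c y /\
     (forall z, z < m -> lt z m = true -> top c m z -> score lt m z <= score lt m y)).
  { intros m Hm Hlm. assert (A := pick_spec lt c m). assert (B := best_fit_eq lt m). fold c in B.
    destruct (pick lt c m) as [y|].
    - exists y. repeat split; try tauto.
    - exfalso. apply (A l0); auto. apply HI; auto; lia. }
  exists l0. constructor; auto.
  - intros m Hm Hlm. unfold pred_of. fold c.
    destruct (Hbig m Hm Hlm) as [y [E [h1 [h2 [h3 [h4 _]]]]]]. rewrite E.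
    repeat split; auto.
    (* A later point on the chain of [m] would lie beyond [I l0 + 2 >= I n + 1], but nothing is
       above [n]. *)
    + intros z hz1 hz2 Ez. destruct (Hch m z) as [C|C]; auto; try lia.
      * apply HI in C; try lia. assert (A := Hmax z hz2). assert (B := Hlow l0 Hl0 Tl0). lra.
      * rewrite Hup in C by lia. discriminate.
    + intro C. apply (C m); auto.
    + apply HI; auto; lia.
  - intros m m' Hm Hm' Hlm Hlm' E. unfold pred_of in E. fold c in E.
    destruct (Hbig m Hm Hlm) as [y [E1 [h1 [h2 [h3 [h4 _]]]]]].
    destruct (Hbig m' Hm' Hlm') as [y' [E1' [h1' [h2' [h3' [h4' _]]]]]].
    rewrite E1, E1' in E. subst y'.
    destruct (lt_eq_lt_dec m m') as [[C|C]|C]; auto; exfalso.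
    + apply (h3' m); auto.
    + apply (h3 m'); auto.
  - intros m y Hm Hy Hlm Ty Hym. unfold pred_of. fold c.
    destruct (Hbig m Hm Hlm) as [t [E [h1 [h2 [h3 [h4 h5]]]]]]. rewrite E. intros Hty z Hz.
    assert (Hym' := Hidx y m Hy Hm Hym).
    assert (A : lt z y = lt z t /\ lt y z = lt t z).
    { apply (score_twins lt m y t); auto.
      - intros u Hu C. apply HI in C; try lia. apply HI; try lia. lra.
      - intros u Hu C. apply HI in C; try lia. apply HI; try lia. lra.
      - apply h5; auto. apply HI; auto; lia. }
    destruct A as [A B].
    rewrite <- !HI by lia. rewrite A, B. tauto.
  - intros P HP. apply (cnt_antichain N (S n) lt w P Hw); [lia|].
    intros x y Hx Hy Px Py C. apply (HP x y Hx Hy Px Py). apply HI; auto; lia.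
Qed.

(** The number of chains grows only when [pick] fails. At that moment every chain has a top and the
    tops obey the stuck bound. *)
Lemma best_fit_bound (N w : nat) (lt : nat -> nat -> bool) :
  is_strict_order N lt -> up_growing N lt -> semi_order N lt -> width_le N lt w ->
  num_chains N (fun i => best_fit i lt) <= floor_nat (phi * INR w).
Proof.
  intros Hso Hup [I HI] Hw.
  assert (Hphi : (1 < phi)%R) by (unfold phi; assert (A := sqrt5_bounds); lra).
  assert (Hfl := floor_nat_spec (phi * INR w)).
  assert (H0 : (0 <= phi * INR w)%R) by (assert (A := pos_INR w); nra).
  assert (G : forall k, k <= N -> num_chains k (fun i => best_fit i lt) <= floor_nat (phi * INR w)).
  { induction k as [|n IH]; intro Hk; [unfold num_chains; simpl; lia|].
    destruct (pick lt (fun i => best_fit i lt) n) as [y|] eqn:E.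
    - apply Nat.le_trans with (num_chains n (fun i => best_fit i lt)); [|apply IH; lia].
      assert (A := pick_spec lt (fun i => best_fit i lt) n). assert (B := best_fit_eq lt n).
      rewrite E in A, B. apply num_chains_le. intros x Hx.
      destruct (Nat.eq_dec x n) as [->|].
      + rewrite B. apply (num_chains_in (fun i => best_fit i lt) n y). tauto.
      + apply (num_chains_in (fun i => best_fit i lt) n x). lia.
    - destruct (best_fit_stuck N w lt I n Hso Hup Hw HI ltac:(lia) E) as [l0 Hst].
      eapply Nat.le_trans; [apply num_chains_tops|].
      set (s := cnt _ _) in *. apply Hfl; auto.
      destruct (le_lt_dec s w) as [C|C].
      + apply le_INR in C. assert (A := pos_INR w). nra.
      + replace s with (w + (s - w)) by lia. apply phi_mul_spec.
        apply (stuck_bound _ _ _ _ _ _ _ Hst). unfold s in *. lia. }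
  apply G. lia.
Qed.

(** * Unit interval representations *)

(* A point [x] is encoded by the interval [thr x, key x] of natural numbers. *)
Definition ltk (thr key : nat -> nat) (y x : nat) : bool := key y <? thr x.

Definition weight (thr key : nat -> nat) (N t : nat) : nat :=
  cnt (fun x => thr x <= t /\ t <= key x) N.

Definition upd (f : nat -> nat) (x v : nat) : nat -> nat := fun i => if i =? x then v else f i.

Lemma upd_eq f x v : upd f x v x = v.
Proof. unfold upd. rewrite Nat.eqb_refl. reflexivity. Qed.

Lemma upd_neq f x v i : i <> x -> upd f x v i = f i.
Proof. intro H. unfold upd. destruct (Nat.eqb_spec i x); congruence. Qed.

Lemma list_R_max (l : list R) : l <> [] -> exists a, In a l /\ forall b, In b l -> (b <= a)%R.
Proof.
  induction l as [|c l IH]; [congruence|]. intros _. destruct l as [|d l].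
  - exists c. split; [simpl; auto|]. intros b [<-|[]]; lra.
  - destruct IH as [a [Ha Hm]]; [discriminate|]. destruct (Rle_dec a c).
    + exists c. split; [simpl; auto|]. intros b [<-|Hb]; [lra|]. specialize (Hm b Hb). lra.
    + exists a. split; [simpl in *; auto|]. intros b [<-|Hb]; [lra|auto].
Qed.

Lemma between_lists (lo hi : list R) :
  (forall a b, In a lo -> In b hi -> (a < b)%R) ->
  exists v, (forall a, In a lo -> (a < v)%R) /\ (forall b, In b hi -> (v < b)%R).
Proof.
  intro H. destruct lo as [|a0 lo]; destruct hi as [|b0 hi].
  - exists 0%R. split; intros ? [].
  - destruct (list_R_max (map Ropp (b0 :: hi))) as [b [Hb Hm]]; [discriminate|].
    exists (- b - 1)%R. split; [intros ? []|]. intros c Hc.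
    assert (- c <= b)%R by (apply Hm, in_map; auto). lra.
  - destruct (list_R_max (a0 :: lo)) as [a [Ha Hm]]; [discriminate|].
    exists (a + 1)%R. split; [|intros ? []]. intros c Hc. specialize (Hm c Hc). lra.
  - destruct (list_R_max (a0 :: lo)) as [a [Ha Hm]]; [discriminate|].
    destruct (list_R_max (map Ropp (b0 :: hi))) as [b [Hb Hm']]; [discriminate|].
    apply in_map_iff in Hb as [b' [<- Hb]]. specialize (H a b' Ha Hb).
    exists ((a + b') / 2)%R. split; intros c Hc.
    + specialize (Hm c Hc). lra.
    + assert (- c <= - b')%R by (apply Hm', in_map; auto). lra.
Qed.

Lemma lex_max (f g : nat -> nat) (l : list nat) : l <> [] ->
  exists m, In m l /\ forall x, In x l -> f x < f m \/ (f x = f m /\ g x <= g m).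
Proof.
  induction l as [|c l IH]; [congruence|]. intros _. destruct l as [|d l].
  - exists c. split; [simpl; auto|]. intros b [<-|[]]; lia.
  - destruct IH as [a [Ha Hm]]; [discriminate|].
    destruct (classic (f a < f c \/ (f a = f c /\ g a <= g c))) as [E|E].
    + exists c. split; [simpl; auto|]. intros b [<-|Hb]; [lia|]. specialize (Hm b Hb). lia.
    + exists a. split; [simpl in *; auto|]. intros b [<-|Hb]; [lia|auto].
Qed.

(* Unit coordinates are assigned in the lexicographic order of (key, thr). *)
Lemma proper_interval_unit (thr key : nat -> nat) (n : nat) : forall l : list nat,
  length l = n ->
  (forall x, In x l -> thr x <= key x) ->
  (forall x y, In x l -> In y l -> key x < key y -> thr x <= thr y) ->
  exists I : nat -> R, forall x y, In x l -> In y l ->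
    (key x < thr y -> (I x + 1 < I y)%R) /\ (thr y <= key x -> (I y < I x + 1)%R) /\
    (key x < key y -> (I x < I y)%R).
Proof.
  induction n as [|n IH]; intros l Hlen Hirr Hmono.
  { destruct l; [|discriminate]. exists (fun _ => 0%R). intros x y []. }
  destruct (lex_max key thr l) as [m [Hm Hmax]]; [intros ->; discriminate|].
  apply in_split in Hm as Hs. destruct Hs as [l1 [l2 El]].
  assert (Hin : forall x, In x l -> x = m \/ In x (l1 ++ l2)).
  { intro x. rewrite El, !in_app_iff. simpl. intuition. }
  assert (Hin' : forall x, In x (l1 ++ l2) -> In x l).
  { intro x. rewrite El, !in_app_iff. simpl. intuition. }
  destruct (IH (l1 ++ l2)) as [I HI].
  - rewrite El, length_app in Hlen. rewrite length_app. simpl in Hlen. lia.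
  - auto.
  - auto.
  (* The last point [m] goes right of all earlier coordinates, beyond [I x + 1] for each [x] below
     it, and before [I x + 1] for the others. The ordering of coordinates by [key] in the induction
     hypothesis makes these demands compatible. *)
  - destruct (between_lists
      (map I (l1 ++ l2) ++ map (fun x => I x + 1)%R (filter (fun x => key x <? thr m) (l1 ++ l2)))
      (map (fun x => I x + 1)%R (filter (fun x => thr m <=? key x) (l1 ++ l2)))) as [v [Hlo Hhi]].
    { intros a b Ha Hb. apply in_map_iff in Hb as [z [<- Hz]]. apply filter_In in Hz as [Hz Hz'].
      apply Nat.leb_le in Hz'. apply in_app_or in Ha as [Ha|Ha].
      - apply in_map_iff in Ha as [x [<- Hx]]. apply (HI z x); auto.
        assert (thr x <= thr m); [|lia].
        destruct (Hmax x (Hin' x Hx)) as [C|C]; [apply Hmono; auto|lia].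
      - apply in_map_iff in Ha as [x [<- Hx]]. apply filter_In in Hx as [Hx Hx'].
        apply Nat.ltb_lt in Hx'. assert (I x < I z)%R by (apply (HI x z); auto; lia). lra. }
    assert (Hlo1 : forall x, In x (l1 ++ l2) -> (I x < v)%R).
    { intros x Hx. apply Hlo, in_or_app. left. apply in_map; auto. }
    assert (Hlo2 : forall x, In x (l1 ++ l2) -> key x < thr m -> (I x + 1 < v)%R).
    { intros x Hx Hk. apply Hlo, in_or_app. right.
      apply (in_map (fun x => I x + 1)%R), filter_In. split; auto. apply Nat.ltb_lt; auto. }
    assert (Hhi1 : forall x, In x (l1 ++ l2) -> thr m <= key x -> (v < I x + 1)%R).
    { intros x Hx Hk. apply Hhi.
      apply (in_map (fun x => I x + 1)%R), filter_In. split; auto. apply Nat.leb_le; auto. }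
    exists (fun i => if i =? m then v else I i). intros x y Hx Hy.
    destruct (Nat.eqb_spec x m) as [->|Hxm]; destruct (Nat.eqb_spec y m) as [->|Hym].
    + assert (A := Hirr m Hm). repeat split; intros; try lia; lra.
    + assert (Hy' : In y (l1 ++ l2)) by (destruct (Hin y Hy); [congruence|auto]).
      assert (A := Hmax y Hy). assert (B := Hirr y Hy). assert (C := Hlo1 y Hy').
      repeat split; intros; try lia; lra.
    + assert (Hx' : In x (l1 ++ l2)) by (destruct (Hin x Hx); [congruence|auto]).
      repeat split; intros; auto.
    + apply HI; [destruct (Hin x Hx)|destruct (Hin y Hy)]; congruence || auto.
Qed.

Lemma proper_semi_order (N : nat) (thr key : nat -> nat) :
  (forall x, x < N -> thr x <= key x) ->
  (forall x y, x < N -> y < N -> key x < key y -> thr x <= thr y) ->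
  semi_order N (ltk thr key).
Proof.
  intros H1 H2. destruct (proper_interval_unit thr key N (seq 0 N)) as [I HI].
  - apply length_seq.
  - intros x Hx. apply in_seq in Hx. apply H1; lia.
  - intros x y Hx Hy. apply in_seq in Hx. apply in_seq in Hy. apply H2; lia.
  - exists I. intros x y Hx Hy. destruct (HI x y) as [A [B _]]; [apply in_seq; lia|apply in_seq; lia|].
    unfold ltk. rewrite Nat.ltb_lt. split; [auto|]. intro C. apply Nat.nle_gt. intro D. specialize (B D). lra.
Qed.

(** This is Helly's theorem on a line: the intervals of an antichain meet pairwise, hence all
    contain their greatest left end. *)
Lemma interval_width (N w : nat) (thr key : nat -> nat) :
  (forall x, x < N -> thr x <= key x) -> (forall t, weight thr key N t <= w) ->
  width_le N (ltk thr key) w.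
Proof.
  intros Hirr Hw l [Hnd [Hl Hanti]]. destruct l as [|a l']; [simpl; lia|]. set (l := a :: l') in *.
  destruct (lex_max thr thr l) as [m [Hm Hmax]]; [discriminate|].
  eapply Nat.le_trans; [|apply (Hw (thr m))]. unfold weight.
  destruct (cnt_list (fun x => thr x <= thr m /\ thr m <= key x) N) as [l2 [_ [Hin <-]]].
  apply NoDup_incl_length; [auto|]. intros x Hx. apply Hin. split; [auto|].
  split; [destruct (Hmax x Hx); lia|].
  destruct (Nat.eq_dec x m) as [->|Hne]; [apply Hirr; auto|].
  apply Nat.nlt_ge. intro C. apply (Hanti x m Hx Hm Hne). left. apply Nat.ltb_lt. auto.
Qed.

Lemma cnt_upd_S (P Q : nat -> Prop) (n : nat) :
  (forall x, x < n -> (P x <-> Q x)) -> cnt P (S n) <= cnt Q n + 1.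
Proof.
  intro H. simpl. rewrite (cnt_ext P Q n H). destruct (excluded_middle_informative (P n)); lia.
Qed.

Lemma cnt_upd_S0 (P Q : nat -> Prop) (n : nat) :
  (forall x, x < n -> (P x <-> Q x)) -> ~ P n -> cnt P (S n) = cnt Q n.
Proof.
  intros H Hn. simpl. rewrite (cnt_ext P Q n H). destruct (excluded_middle_informative (P n)); [tauto|lia].
Qed.

Lemma cnt_remove (P Q : nat -> Prop) (n y : nat) :
  y < n -> (forall x, x < n -> P x -> Q x) -> ~ P y -> Q y -> cnt P n + 1 <= cnt Q n.
Proof.
  intros Hy H HP HQ.
  assert (cnt P n + cnt (fun x => x = y) n <= cnt Q n).
  { apply cnt_add; [intros x _ hp ->; tauto|intros x Hx [hp| ->]; auto]. }
  assert (0 < cnt (fun x => x = y) n) by (apply cnt_pos with y; auto). lia.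
Qed.

(** * Spoiler's positions *)

(* Group j occupies the coordinates j (w + 1), ..., j (w + 1) + w. Its unused elements have the last
   one as [key]; the s-th element that gets used (s = 0, 1, ...) is moved to j (w + 1) + s. The
   points of a descent have [top_key], and nothing is ever presented above them. *)
Definition top_key (w : nat) : nat := (w + 3) * S w.

Definition forced (alg : nat -> (nat -> nat -> bool) -> nat) (w target : nat) : Prop :=
  exists (N : nat) (lt : nat -> nat -> bool),
    is_strict_order N lt /\ up_growing N lt /\ semi_order N lt /\ width_eq N lt w /\
    (~ chain_partition N lt (fun i => alg i lt) \/ target <= num_chains N (fun i => alg i lt)).

(* [u j] is the number of used elements of group j, [p] the number of used elements of group 0
   not yet answered by a point of group J + 1, and [c] the number of chains guaranteed once they
   are. *)
Record position (alg : nat -> (nat -> nat -> bool) -> nat) (w J N : nat) (thr key u : nat -> nat)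
    (p c : nat) : Prop := {
  po_w : 0 < w;
  po_J : J <= w;
  po_key : forall x, x < N ->
    (exists j s, j <= J /\ key x = j * S w + s /\ (s = w \/ s < u j)) \/ key x = top_key w;
  po_thr_low : forall x, x < N -> key x < top_key w -> thr x <= u 0;
  po_thr_up : forall x, x < N -> key x = top_key w ->
    exists j s, 1 <= j <= S J /\ s <= u j /\ thr x = j * S w + s;
  po_mono : forall x y, x < N -> y < N -> key x < top_key w -> key y < top_key w ->
    key x / S w <= key y / S w -> thr x <= thr y;
  po_up : forall x y, x <= y -> y < N -> thr x <= key y;
  po_used : forall y j s, y < N -> j <= J -> key y = j * S w + s -> s < u j ->
    exists z, z < N /\ key z = top_key w /\ alg z (ltk thr key) = alg y (ltk thr key);
  po_cnt : forall j, u j + cnt (fun x => key x = j * S w + w) N <= w;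
  po_u : forall j, J < j -> u j = 0;
  po_first : w <= N /\ forall x, x < w -> thr x = 0;
  po_ground : forall t, t < S w -> weight thr key N t + (if u 0 <=? t then p else 0) <= w;
  po_col : c <= num_chains N (fun i => alg i (ltk thr key)) + p
}.

Lemma group_lt (w j j' s s' : nat) : j < j' -> s <= w -> j * S w + s < j' * S w + s'.
Proof. intros. nia. Qed.

Lemma group_inj (w j j' s s' : nat) :
  s <= w -> s' <= w -> j * S w + s = j' * S w + s' -> j = j' /\ s = s'.
Proof.
  intros H1 H2 E. destruct (lt_eq_lt_dec j j') as [[C|C]|C].
  - assert (A := group_lt w j j' s s' C H1). lia.
  - subst. lia.
  - assert (A := group_lt w j' j s' s C H2). lia.
Qed.

Lemma group_div (w j s : nat) : s <= w -> (j * S w + s) / S w = j.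
Proof. intro H. rewrite Nat.div_add_l by lia. rewrite Nat.div_small; lia. Qed.

Lemma top_key_gt (w j s : nat) : j <= S w -> s <= w -> j * S w + s < top_key w.
Proof. intros H1 H2. unfold top_key. nia. Qed.

Lemma position_u (alg : nat -> (nat -> nat -> bool) -> nat) w J N thr key u p c :
  position alg w J N thr key u p c -> forall j, u j <= w.
Proof. intros H j. assert (A := po_cnt _ _ _ _ _ _ _ _ _ H j). lia. Qed.

Lemma position_key_le alg w J N thr key u p c :
  position alg w J N thr key u p c -> forall x, x < N -> key x <= top_key w.
Proof.
  intros H x Hx. assert (Hu := position_u _ _ _ _ _ _ _ _ _ H).
  assert (HJ := po_J _ _ _ _ _ _ _ _ _ H).
  destruct (po_key _ _ _ _ _ _ _ _ _ H x Hx) as [[j [s [A [B C]]]]|B]; [|lia].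
  specialize (Hu j). assert (D := top_key_gt w j s ltac:(lia) ltac:(lia)). lia.
Qed.

Lemma position_weaken alg w J N thr key u p c c' :
  position alg w J N thr key u p c -> c' <= num_chains N (fun i => alg i (ltk thr key)) + p ->
  position alg w J N thr key u p c'.
Proof. intros [] H. constructor; auto. Qed.

(** Spoiler may stop at any position within the width bound; the first [w] points witness that width
    [w] is attained. *)
Lemma position_forced alg w target J N thr key u p c :
  position alg w J N thr key u p c ->
  (forall t, S w <= t -> weight thr key N t <= w) ->
  (~ chain_partition N (ltk thr key) (fun i => alg i (ltk thr key)) \/
   target <= num_chains N (fun i => alg i (ltk thr key))) ->
  forced alg w target.
Proof.
  intros H HW Hgoal. exists N, (ltk thr key).
  assert (Hup := po_up _ _ _ _ _ _ _ _ _ H).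
  assert (Hkl := position_key_le _ _ _ _ _ _ _ _ _ H).
  assert (Hu := position_u _ _ _ _ _ _ _ _ _ H).
  assert (Hirr : forall x, x < N -> thr x <= key x) by (intros; apply Hup; auto).
  split; [|split; [|split; [|split; [|exact Hgoal]]]].
  - split.
    + intros x Hx. apply Nat.ltb_ge. auto.
    + intros x y z Hx Hy Hz A B. apply Nat.ltb_lt in A, B. apply Nat.ltb_lt.
      specialize (Hirr y Hy). lia.
  - intros i j Hji Hi. apply Nat.ltb_ge. apply Hup; auto; lia.
  - apply proper_semi_order; auto. intros x y Hx Hy Hk.
    (* Points with [top_key] have thresholds at least [S w], beyond the bound [u 0] for all others,
       so thresholds are monotone in keys. *)
    specialize (Hkl y Hy) as Hky. destruct (Nat.eq_dec (key y) (top_key w)) as [E|E].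
    + assert (A := po_thr_low _ _ _ _ _ _ _ _ _ H x Hx ltac:(lia)).
      destruct (po_thr_up _ _ _ _ _ _ _ _ _ H y Hy E) as [j [s [B [_ D]]]].
      specialize (Hu 0). nia.
    + apply (po_mono _ _ _ _ _ _ _ _ _ H); auto; try lia. apply Nat.Div0.div_le_mono. lia.
  - split.
    + apply interval_width; auto. intro t. destruct (le_lt_dec (S w) t) as [C|C]; auto.
      assert (A := po_ground _ _ _ _ _ _ _ _ _ H t C). lia.
    + destruct (po_first _ _ _ _ _ _ _ _ _ H) as [A B].
      exists (seq 0 w). split; [|apply length_seq]. split; [apply seq_NoDup|]. split.
      * intros x Hx. apply in_seq in Hx. lia.
      * intros x y Hx Hy _ [C|C]; apply in_seq in Hx; apply in_seq in Hy;
          apply Nat.ltb_lt in C; rewrite B in C; lia.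
Qed.

(** * Chain counts and the effect of one move on a position *)

Lemma num_chains_ext (c c' : nat -> nat) (k : nat) :
  (forall x, x < k -> c x = c' x) -> num_chains k c = num_chains k c'.
Proof.
  intro H. unfold num_chains. do 2 f_equal. apply map_ext_in. intros x Hx.
  apply in_seq in Hx. apply H. lia.
Qed.

Lemma num_chains_S (c : nat -> nat) (k : nat) : num_chains k c <= num_chains (S k) c.
Proof.
  unfold num_chains. apply NoDup_incl_length; [apply NoDup_nodup|].
  intros y Hy. apply nodup_In in Hy. apply nodup_In. rewrite seq_S, map_app. apply in_or_app; auto.
Qed.

Lemma num_chains_new (c : nat -> nat) (k : nat) :
  (forall x, x < k -> c x <> c k) -> num_chains (S k) c = S (num_chains k c).
Proof.
  intro H. unfold num_chains. rewrite seq_S, map_app. simpl.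
  assert (A : forall l, ~ In (c k) l ->
    length (nodup Nat.eq_dec (l ++ [c k])) = S (length (nodup Nat.eq_dec l))).
  { induction l as [|a l IH]; intro Hn; [reflexivity|]. simpl in Hn. simpl.
    destruct (in_dec Nat.eq_dec a (l ++ [c k])) as [B|B]; destruct (in_dec Nat.eq_dec a l) as [B'|B'].
    - apply IH; tauto.
    - exfalso. apply in_app_or in B as [B|[B|[]]]; [tauto|]. apply Hn. auto.
    - exfalso. apply B, in_or_app; auto.
    - simpl. rewrite IH; tauto. }
  apply A. intro B. apply in_map_iff in B as [x [E Hx]]. apply in_seq in Hx. apply (H x); auto; lia.
Qed.

Lemma online_ext alg n lt lt' : online alg ->
  (forall i j, i < n -> j < n -> lt i j = lt' i j) -> forall x, x < n -> alg x lt = alg x lt'.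
Proof. intros Ho H x Hx. apply Ho. intros i j Hi Hj. apply H; lia. Qed.

Lemma ltk_upd N thr key a b : forall i j, i < N -> j < N ->
  ltk thr key i j = ltk (upd thr N a) (upd key N b) i j.
Proof. intros i j Hi Hj. unfold ltk. rewrite !upd_neq by lia. reflexivity. Qed.

Lemma weight_S N thr key a b t :
  weight (upd thr N a) (upd key N b) (S N) t
  <= weight thr key N t + (if (a <=? t) && (t <=? b) then 1 else 0).
Proof.
  unfold weight. destruct ((a <=? t) && (t <=? b)) eqn:E.
  - apply cnt_upd_S. intros x Hx. rewrite !upd_neq by lia. tauto.
  - rewrite (cnt_upd_S0 _ (fun x => thr x <= t /\ t <= key x)); [lia| |].
    + intros x Hx. rewrite !upd_neq by lia. tauto.
    + rewrite !upd_eq. rewrite andb_false_iff, !Nat.leb_gt in E. lia.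
Qed.

Lemma add_upper alg w J N thr key u p c j s : online alg ->
  position alg w J N thr key u p c -> 1 <= j <= S J -> s <= u j ->
  let thr' := upd thr N (j * S w + s) in
  let key' := upd key N (top_key w) in
  position alg w J (S N) thr' key' u p c /\
  (chain_partition (S N) (ltk thr' key') (fun i => alg i (ltk thr' key')) ->
   position alg w J (S N) thr' key' u p (S c) \/
   exists l y, l < j /\ y < N /\ key' y = l * S w + w /\
     alg N (ltk thr' key') = alg y (ltk thr' key')).
Proof.
  intros Ho H Hj Hs thr' key'.
  assert (Hu := position_u _ _ _ _ _ _ _ _ _ H).
  assert (HJ := po_J _ _ _ _ _ _ _ _ _ H).
  assert (Hkl := position_key_le _ _ _ _ _ _ _ _ _ H).
  assert (Hcol : forall x, x < N -> alg x (ltk thr key) = alg x (ltk thr' key')).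
  { apply online_ext; auto. apply ltk_upd. }
  assert (Et : forall x, x < N -> thr' x = thr x) by (intros; apply upd_neq; lia).
  assert (Ek : forall x, x < N -> key' x = key x) by (intros; apply upd_neq; lia).
  assert (EtN : thr' N = j * S w + s) by apply upd_eq.
  assert (EkN : key' N = top_key w) by apply upd_eq.
  assert (Htj : j * S w + s < top_key w) by (apply top_key_gt; [lia|specialize (Hu j); lia]).
  assert (HP : position alg w J (S N) thr' key' u p c).
  { constructor.
    - apply (po_w _ _ _ _ _ _ _ _ _ H).
    - auto.
    - intros x Hx. destruct (Nat.eq_dec x N) as [->|]; [auto|].
      rewrite Ek by lia. apply (po_key _ _ _ _ _ _ _ _ _ H); lia.
    - intros x Hx. destruct (Nat.eq_dec x N) as [->|]; [lia|].
      rewrite Ek, Et by lia. apply (po_thr_low _ _ _ _ _ _ _ _ _ H); lia.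
    - intros x Hx. destruct (Nat.eq_dec x N) as [->|]; [intros _; exists j, s; auto|].
      rewrite Ek, Et by lia. apply (po_thr_up _ _ _ _ _ _ _ _ _ H); lia.
    - intros x y Hx Hy. destruct (Nat.eq_dec x N) as [->|]; [lia|].
      destruct (Nat.eq_dec y N) as [->|]; [lia|].
      rewrite !Ek, !Et by lia. apply (po_mono _ _ _ _ _ _ _ _ _ H); lia.
    - intros x y Hxy Hy. destruct (Nat.eq_dec y N) as [->|].
      + rewrite EkN. destruct (Nat.eq_dec x N) as [->|]; [lia|]. rewrite Et by lia.
        assert (A := po_up _ _ _ _ _ _ _ _ _ H x x (Nat.le_refl _) ltac:(lia)).
        specialize (Hkl x ltac:(lia)). lia.
      + rewrite Ek, Et by lia. apply (po_up _ _ _ _ _ _ _ _ _ H); lia.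
    - intros y i r Hy Hi. destruct (Nat.eq_dec y N) as [->|].
      + intros E Hr. specialize (Hu i). assert (A := top_key_gt w i r ltac:(lia) ltac:(lia)). lia.
      + rewrite Ek by lia. intros E Hr.
        destruct (po_used _ _ _ _ _ _ _ _ _ H y i r ltac:(lia) Hi E Hr) as [z [Hz [Ez Ec]]].
        exists z. rewrite Ek, <- !Hcol by lia. auto.
    - intro i. rewrite (cnt_upd_S0 _ (fun x => key x = i * S w + w)).
      + apply (po_cnt _ _ _ _ _ _ _ _ _ H).
      + intros x Hx. rewrite Ek by lia. tauto.
      + rewrite EkN. unfold top_key. destruct (le_lt_dec i (S w)) as [C|C].
        * assert (A := top_key_gt w i w C (Nat.le_refl _)). unfold top_key in A. lia.
        * intro E. replace ((w + 3) * S w) with ((w + 3) * S w + 0) in E by lia.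
          assert (Hw := po_w _ _ _ _ _ _ _ _ _ H). apply group_inj in E; lia.
    - apply (po_u _ _ _ _ _ _ _ _ _ H).
    - destruct (po_first _ _ _ _ _ _ _ _ _ H) as [A B]. split; [lia|].
      intros x Hx. rewrite Et by lia. auto.
    - intros t Ht. assert (A := po_ground _ _ _ _ _ _ _ _ _ H t Ht).
      assert (B := weight_S N thr key (j * S w + s) (top_key w) t). fold thr' key' in B.
      destruct (Nat.leb_spec (j * S w + s) t) as [C|C]; [nia|]. simpl in B. lia.
    - assert (A := po_col _ _ _ _ _ _ _ _ _ H).
      rewrite (num_chains_ext _ _ N Hcol) in A.
      assert (B := num_chains_S (fun i => alg i (ltk thr' key')) N). lia. }
  split; [exact HP|]. intro Hch.
  destruct (classic (exists x, x < N /\ alg x (ltk thr' key') = alg N (ltk thr' key'))) as [[x [Hx Ex]]|Hno].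
  - right.
    assert (Hup := po_up _ _ _ _ _ _ _ _ _ HP).
    assert (Hlt : key' x < thr' N).
    { destruct (Hch x N) as [C|C]; auto; try lia; apply Nat.ltb_lt in C; auto.
      specialize (Hup x N ltac:(lia) ltac:(lia)). lia. }
    rewrite EtN in Hlt.
    destruct (po_key _ _ _ _ _ _ _ _ _ H x Hx) as [[l [r [A [B C]]]]|B].
    2: { rewrite Ek in Hlt by lia. lia. }
    destruct (Nat.eq_dec r w) as [->|Hr].
    + exists l, x. rewrite Ek in * by lia. repeat split; auto.
      apply Nat.nle_gt. intro D. specialize (Hu j). nia.
    + destruct C as [C|C]; [lia|]. exfalso.
      destruct (po_used _ _ _ _ _ _ _ _ _ H x l r Hx A B C) as [z [Hz [Ez Ec]]].
      rewrite !Hcol in Ec by lia.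
      destruct (Hch z N) as [D|D]; try lia; apply Nat.ltb_lt in D.
      * rewrite Ek, EtN in D by lia. lia.
      * specialize (Hup z N ltac:(lia) ltac:(lia)). lia.
  - left. apply position_weaken with c; auto.
    assert (A := po_col _ _ _ _ _ _ _ _ _ H). rewrite (num_chains_ext _ _ N Hcol) in A.
    rewrite num_chains_new; [lia|]. intros x Hx E. apply Hno. exists x; auto.
Qed.

Lemma rekey alg w J N thr key u p c l y z : online alg ->
  position alg w J N thr key u p c -> l <= J -> y < N -> key y = l * S w + w ->
  z < N -> key z = top_key w -> alg z (ltk thr key) = alg y (ltk thr key) ->
  let key' := upd key y (l * S w + u l) in
  let u' := upd u l (S (u l)) in
  position alg w J N thr key' u' (if l =? 0 then S p else p) (if l =? 0 then S c else c) /\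
  (forall t, weight thr key' N t + (if (l * S w + S (u l) <=? t) && (t <=? l * S w + w) then 1 else 0)
     <= weight thr key N t).
Proof.
  intros Ho H Hl Hy Ey Hz Ez Ec key' u'.
  assert (Hu := position_u _ _ _ _ _ _ _ _ _ H).
  assert (HJ := po_J _ _ _ _ _ _ _ _ _ H).
  assert (Hul : u l < w).
  { assert (A := po_cnt _ _ _ _ _ _ _ _ _ H l).
    assert (0 < cnt (fun x => key x = l * S w + w) N) by (apply cnt_pos with y; auto). lia. }
  assert (Ek : forall x, x <> y -> key' x = key x) by (intros; apply upd_neq; auto).
  assert (Eky : key' y = l * S w + u l) by apply upd_eq.
  assert (Eul : u' l = S (u l)) by apply upd_eq.
  assert (Eu : forall j, j <> l -> u' j = u j) by (intros; apply upd_neq; auto).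
  assert (Hmon : forall j, u j <= u' j).
  { intro j. destruct (Nat.eq_dec j l) as [->|]; [lia|rewrite Eu; auto]. }
  assert (Htop : l * S w + w < top_key w) by (apply top_key_gt; lia).
  (* No threshold falls in the stretch over which the key of [y] moves. *)
  assert (Hthr : forall x, x < N -> thr x <= l * S w + u l \/ l * S w + w < thr x).
  { intros x Hx. destruct (Nat.eq_dec (key x) (top_key w)) as [E|E].
    - destruct (po_thr_up _ _ _ _ _ _ _ _ _ H x Hx E) as [j [s [A [B C]]]]. specialize (Hu j).
      destruct (lt_eq_lt_dec j l) as [[D|D]|D]; [left|left; subst; lia|right].
      + assert (F := group_lt w j l s (u l) D ltac:(lia)). lia.
      + assert (F := group_lt w l j w s D ltac:(lia)). lia.
    - left. assert (A := po_thr_low _ _ _ _ _ _ _ _ _ H x Hx).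
      assert (B := position_key_le _ _ _ _ _ _ _ _ _ H x Hx). specialize (A ltac:(lia)).
      specialize (Hu 0). destruct l; nia. }
  assert (Hty : thr y <= l * S w + u l).
  { destruct (Hthr y Hy); auto. assert (A := po_up _ _ _ _ _ _ _ _ _ H y y (Nat.le_refl _) Hy). lia. }
  assert (Hlt : forall i j, i < N -> j < N -> ltk thr key i j = ltk thr key' i j).
  { intros i j Hi Hj. unfold ltk. destruct (Nat.eq_dec i y) as [->|]; [|rewrite Ek; auto].
    rewrite Ey, Eky. destruct (Hthr j Hj);
      destruct (Nat.ltb_spec (l * S w + w) (thr j)); destruct (Nat.ltb_spec (l * S w + u l) (thr j)); lia. }
  assert (Hcol := online_ext alg N _ _ Ho Hlt).
  assert (HW : forall t, weight thr key' N t
     + (if (l * S w + S (u l) <=? t) && (t <=? l * S w + w) then 1 else 0) <= weight thr key N t).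
  { intro t. unfold weight. destruct ((l * S w + S (u l) <=? t) && (t <=? l * S w + w)) eqn:E.
    - rewrite andb_true_iff, !Nat.leb_le in E. apply cnt_remove with y; auto; try lia.
      intros x Hx. destruct (Nat.eq_dec x y) as [->|]; [lia|rewrite Ek; auto].
    - rewrite Nat.add_0_r. apply cnt_le.
      intros x Hx. destruct (Nat.eq_dec x y) as [->|]; [lia|rewrite Ek; auto]. }
  split; [|exact HW]. constructor.
  - apply (po_w _ _ _ _ _ _ _ _ _ H).
  - auto.
  - intros x Hx. destruct (Nat.eq_dec x y) as [->|].
    + left. exists l, (u l). repeat split; auto. lia.
    + rewrite Ek by auto. destruct (po_key _ _ _ _ _ _ _ _ _ H x Hx) as [[j [s [A [B C]]]]|B]; [left|auto].
      exists j, s. specialize (Hmon j). repeat split; auto. lia.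
  - intros x Hx Hk. apply Nat.le_trans with (u 0); [|apply Hmon].
    apply (po_thr_low _ _ _ _ _ _ _ _ _ H); auto.
    destruct (Nat.eq_dec x y) as [->|]; [lia|rewrite Ek in Hk; auto].
  - intros x Hx Hk. destruct (Nat.eq_dec x y) as [->|]; [lia|]. rewrite Ek in Hk by auto.
    destruct (po_thr_up _ _ _ _ _ _ _ _ _ H x Hx Hk) as [j [s [A [B C]]]].
    exists j, s. specialize (Hmon j). repeat split; lia.
  - assert (Hd : forall x, key' x / S w = key x / S w).
    { intro x. destruct (Nat.eq_dec x y) as [->|]; [|rewrite Ek; auto].
      rewrite Eky, Ey, !group_div by lia. reflexivity. }
    assert (Hd' : forall x, key' x < top_key w -> key x < top_key w).
    { intro x. destruct (Nat.eq_dec x y) as [->|]; [lia|rewrite Ek; auto]. }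
    intros x x' Hx Hx' h1 h2. rewrite !Hd. apply (po_mono _ _ _ _ _ _ _ _ _ H); auto.
  - intros x x' Hxx Hx'. destruct (Nat.eq_dec x' y) as [->|].
    + rewrite Eky. destruct (Hthr x ltac:(lia)) as [A|A]; auto.
      assert (B := po_up _ _ _ _ _ _ _ _ _ H x y Hxx Hy). lia.
    + rewrite Ek by auto. apply (po_up _ _ _ _ _ _ _ _ _ H); auto.
  - intros x j s Hx Hj E Hs. destruct (Nat.eq_dec x y) as [->|].
    + exists z. rewrite <- !Hcol by auto. rewrite Ek by (intros ->; lia). auto.
    + rewrite Ek in E by auto. destruct (Nat.eq_dec s (u l)) as [->|Hne].
      * destruct (Nat.eq_dec j l) as [->|Hjl].
        -- destruct (po_key _ _ _ _ _ _ _ _ _ H x Hx) as [[j' [s [A [B C]]]]|B]; [|lia].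
           rewrite E in B. specialize (Hu j'). apply group_inj in B; try lia. destruct B; subst. lia.
        -- rewrite Eu in Hs by auto.
           destruct (po_used _ _ _ _ _ _ _ _ _ H x j _ Hx Hj E Hs) as [z' [A [B C]]].
           exists z'. rewrite <- !Hcol by auto. rewrite Ek by (intros ->; lia). auto.
      * assert (Hs' : s < u j).
        { destruct (Nat.eq_dec j l) as [->|]; [lia|rewrite <- Eu; auto]. }
        destruct (po_used _ _ _ _ _ _ _ _ _ H x j _ Hx Hj E Hs') as [z' [A [B C]]].
        exists z'. rewrite <- !Hcol by auto. rewrite Ek by (intros ->; lia). auto.
  - intro j. assert (A := po_cnt _ _ _ _ _ _ _ _ _ H j). destruct (Nat.eq_dec j l) as [->|Hjl].
    + rewrite Eul. assert (B : cnt (fun x => key' x = l * S w + w) N + 1 <= cnt (fun x => key x = l * S w + w) N).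
      { apply cnt_remove with y; auto; try lia.
        intros x Hx. destruct (Nat.eq_dec x y) as [->|]; [lia|rewrite Ek; auto]. }
      lia.
    + rewrite Eu by auto.
      assert (B : cnt (fun x => key' x = j * S w + w) N <= cnt (fun x => key x = j * S w + w) N).
      { apply cnt_le. intros x Hx. destruct (Nat.eq_dec x y) as [->|]; [|rewrite Ek; auto].
        rewrite Eky. intro E. apply group_inj in E; lia. }
      lia.
  - intros j Hj. rewrite Eu by lia. apply (po_u _ _ _ _ _ _ _ _ _ H); auto.
  - apply (po_first _ _ _ _ _ _ _ _ _ H).
  - intros t Ht. assert (A := po_ground _ _ _ _ _ _ _ _ _ H t Ht). specialize (HW t).
    (* For [l = 0] the room promised to the extra answering point is exactly what [y] vacates. *)
    destruct (Nat.eqb_spec l 0) as [->|Hl0].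
    + rewrite Eul. rewrite !Nat.mul_0_l, !Nat.add_0_l in HW.
      destruct (Nat.leb_spec t w) as [C|C]; [rewrite andb_true_r in HW|lia].
      destruct (Nat.leb_spec (u 0) t); destruct (S (u 0) <=? t) eqn:E; try lia.
      apply Nat.leb_le in E. lia.
    + rewrite Eu by auto. lia.
  - assert (A := po_col _ _ _ _ _ _ _ _ _ H). rewrite (num_chains_ext _ _ N Hcol) in A.
    destruct (l =? 0); lia.
Qed.

(** A point of group [J] is above used elements of group 0 only, and their chains already continue
    to a point of [top_key]. So a new chain is forced and one unit of [p] is redeemed. *)
Lemma add_lower alg w J N thr key u p c : online alg ->
  position alg w J N thr key u (S p) c -> 1 <= J -> u J = 0 ->
  (forall x, x < N -> key x < top_key w -> key x / S w = J -> thr x = u 0) ->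
  (forall x, x < N -> thr x <= J * S w) ->
  cnt (fun x => key x = J * S w + w) N + S p <= w ->
  (forall t, S w <= t -> weight thr key N t + (if t <? S J * S w then S p else 0) <= w) ->
  forall target,
  let thr' := upd thr N (u 0) in
  let key' := upd key N (J * S w + w) in
  (position alg w J (S N) thr' key' u p c -> forced alg w target) -> forced alg w target.
Proof.
  intros Ho H HJ1 HuJ Hnew Hthr Hcnt HWt target thr' key' Hk.
  assert (Hu := position_u _ _ _ _ _ _ _ _ _ H).
  assert (HJ := po_J _ _ _ _ _ _ _ _ _ H).
  assert (Hkl := position_key_le _ _ _ _ _ _ _ _ _ H).
  assert (Hcol : forall x, x < N -> alg x (ltk thr key) = alg x (ltk thr' key')).
  { apply online_ext; auto. apply ltk_upd. }
  assert (Et : forall x, x < N -> thr' x = thr x) by (intros; apply upd_neq; lia).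
  assert (Ek : forall x, x < N -> key' x = key x) by (intros; apply upd_neq; lia).
  assert (EtN : thr' N = u 0) by apply upd_eq.
  assert (EkN : key' N = J * S w + w) by apply upd_eq.
  assert (HkN : J * S w + w < top_key w) by (apply top_key_gt; lia).
  assert (H0 := Hu 0).
  (* Before the new chain is established the guarantee is only [c - 1], since [p] has dropped by
     one. *)
  assert (HP : position alg w J (S N) thr' key' u p (c - 1)).
  { constructor.
    - apply (po_w _ _ _ _ _ _ _ _ _ H).
    - auto.
    - intros x Hx. destruct (Nat.eq_dec x N) as [->|]; [left; exists J, w; auto|].
      rewrite Ek by lia. apply (po_key _ _ _ _ _ _ _ _ _ H); lia.
    - intros x Hx. destruct (Nat.eq_dec x N) as [->|]; [lia|].
      rewrite Ek, Et by lia. apply (po_thr_low _ _ _ _ _ _ _ _ _ H); lia.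
    - intros x Hx. destruct (Nat.eq_dec x N) as [->|]; [lia|].
      rewrite Ek, Et by lia. apply (po_thr_up _ _ _ _ _ _ _ _ _ H); lia.
    - intros x y Hx Hy. destruct (Nat.eq_dec x N) as [->|]; destruct (Nat.eq_dec y N) as [->|].
      + lia.
      + rewrite EkN, EtN, Ek, Et by lia. rewrite group_div by lia. intros _ h1 h2.
        destruct (po_key _ _ _ _ _ _ _ _ _ H y ltac:(lia)) as [[j [s [A [B C]]]]|B]; [|lia].
        assert (D : key y / S w = j) by (rewrite B; apply group_div; specialize (Hu j); lia).
        rewrite (Hnew y); lia.
      + rewrite EkN, EtN, Ek, Et by lia. intros h1 _ _.
        apply (po_thr_low _ _ _ _ _ _ _ _ _ H); lia.
      + rewrite !Ek, !Et by lia. apply (po_mono _ _ _ _ _ _ _ _ _ H); lia.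
    - intros x y Hxy Hy. destruct (Nat.eq_dec y N) as [->|].
      + rewrite EkN. destruct (Nat.eq_dec x N) as [->|]; [lia|]. rewrite Et by lia.
        specialize (Hthr x ltac:(lia)). lia.
      + rewrite Ek, Et by lia. apply (po_up _ _ _ _ _ _ _ _ _ H); lia.
    - intros y i r Hy Hi. destruct (Nat.eq_dec y N) as [->|].
      + rewrite EkN. intros E Hr. specialize (Hu i). apply group_inj in E; try lia.
      + rewrite Ek by lia. intros E Hr.
        destruct (po_used _ _ _ _ _ _ _ _ _ H y i r ltac:(lia) Hi E Hr) as [z [Hz [Ez Ec]]].
        exists z. rewrite Ek, <- !Hcol by lia. auto.
    - intro i. destruct (Nat.eq_dec i J) as [->|Hi].
      + assert (A : cnt (fun x => key' x = J * S w + w) (S N) <= cnt (fun x => key x = J * S w + w) N + 1).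
        { apply cnt_upd_S. intros x Hx. rewrite Ek by lia. tauto. }
        lia.
      + rewrite (cnt_upd_S0 _ (fun x => key x = i * S w + w)).
        * apply (po_cnt _ _ _ _ _ _ _ _ _ H).
        * intros x Hx. rewrite Ek by lia. tauto.
        * rewrite EkN. intro E. apply group_inj in E; lia.
    - apply (po_u _ _ _ _ _ _ _ _ _ H).
    - destruct (po_first _ _ _ _ _ _ _ _ _ H) as [A B]. split; [lia|].
      intros x Hx. rewrite Et by lia. auto.
    - intros t Ht. assert (A := po_ground _ _ _ _ _ _ _ _ _ H t Ht).
      assert (B := weight_S N thr key (u 0) (J * S w + w) t). fold thr' key' in B.
      destruct (Nat.leb_spec (u 0) t) as [C|C]; simpl in B; [|lia].
      destruct (t <=? J * S w + w); lia.
    - assert (A := po_col _ _ _ _ _ _ _ _ _ H).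
      rewrite (num_chains_ext _ _ N Hcol) in A.
      assert (B := num_chains_S (fun i => alg i (ltk thr' key')) N). lia. }
  assert (HW' : forall t, S w <= t -> weight thr' key' (S N) t <= w).
  { intros t Ht. assert (B := weight_S N thr key (u 0) (J * S w + w) t). fold thr' key' in B.
    specialize (HWt t Ht). destruct (Nat.ltb_spec t (S J * S w)) as [C|C].
    - destruct ((u 0 <=? t) && (t <=? J * S w + w)); lia.
    - destruct (Nat.leb_spec t (J * S w + w)); [lia|]. rewrite andb_false_r in B. lia. }
  destruct (classic (chain_partition (S N) (ltk thr' key') (fun i => alg i (ltk thr' key')))) as [Hch|Hch].
  2: { apply (position_forced _ _ _ _ _ _ _ _ _ _ HP); auto. }
  apply Hk. apply position_weaken with (c - 1); auto.
  assert (A := po_col _ _ _ _ _ _ _ _ _ H). rewrite (num_chains_ext _ _ N Hcol) in A.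
  rewrite num_chains_new; [lia|]. intros x Hx Ex.
  assert (Hup := po_up _ _ _ _ _ _ _ _ _ HP).
  assert (Hlt : key' x < thr' N).
  { destruct (Hch x N) as [C|C]; auto; try lia; apply Nat.ltb_lt in C; auto.
    specialize (Hup x N ltac:(lia) ltac:(lia)). lia. }
  rewrite EtN, Ek in Hlt by lia.
  destruct (po_key _ _ _ _ _ _ _ _ _ H x Hx) as [[l [r [B1 [B2 B3]]]]|B]; [|lia].
  assert (l = 0) by nia. subst l. assert (Hr : r < u 0) by lia.
  destruct (po_used _ _ _ _ _ _ _ _ _ H x 0 r Hx B1 B2 Hr) as [z [Hz [Ez Ec]]].
  rewrite !Hcol in Ec by lia.
  destruct (Hch z N) as [D|D]; try lia; apply Nat.ltb_lt in D.
  - rewrite Ek, EtN in D by lia. lia.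
  - specialize (Hup z N ltac:(lia) ltac:(lia)). lia.
Qed.

(** * Spoiler's strategy *)

(* Every point of the cascade that reuses a chain pushes the play into a strictly lower group,
   so it ends with a new chain or with a chain whose top was an original minimal point. *)
Lemma cascade alg w target J c (B : nat -> nat) : online alg ->
  (forall t, S w <= t -> B t <= w) ->
  forall j s N thr key u p, position alg w J N thr key u p c -> 1 <= j <= S J -> s <= u j ->
  (forall t, S w <= t -> weight thr key N t + (if j * S w + s <=? t then 1 else 0)
     + pred (Nat.min (t / S w) j) <= B t) ->
  (forall N' thr' key' u' p', position alg w J N' thr' key' u' p' (S c) -> p' <= S p ->
     (forall t, S w <= t -> weight thr' key' N' t <= B t) -> forced alg w target) ->
  forced alg w target.
Proof.
  (* The term [pred (Nat.min (t / S w) j)] counts the groups [l] with [1 <= l < j] and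
     [l < t / S w]: only descents into these can add weight at [t]. *)
  intros Ho HB j. induction j as [j IH] using (well_founded_induction lt_wf).
  intros s N thr key u p H Hj Hs HW K.
  destruct (add_upper alg w J N thr key u p c j s Ho H Hj Hs) as [HP Hout].
  set (thr' := upd thr N (j * S w + s)) in *. set (key' := upd key N (top_key w)) in *.
  assert (HW' : forall t, weight thr' key' (S N) t
     <= weight thr key N t + (if j * S w + s <=? t then 1 else 0)).
  { intro t. assert (A := weight_S N thr key (j * S w + s) (top_key w) t). fold thr' key' in A.
    destruct (j * S w + s <=? t); simpl in A; [destruct (t <=? top_key w)|]; lia. }
  destruct (classic (chain_partition (S N) (ltk thr' key') (fun i => alg i (ltk thr' key')))) as [Hch|Hch].
  2: { apply (position_forced _ _ _ _ _ _ _ _ _ _ HP); auto.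
       intros t Ht. specialize (HW t Ht). specialize (HW' t). specialize (HB t Ht). lia. }
  destruct (Hout Hch) as [HP'|[l [y [Hl [Hy [Ey Ec]]]]]].
  { apply (K _ _ _ _ _ HP'); [lia|]. intros t Ht. specialize (HW t Ht). specialize (HW' t). lia. }
  assert (EN : key' N = top_key w) by apply upd_eq.
  destruct (rekey alg w J (S N) thr' key' u p c l y N Ho HP ltac:(lia) ltac:(lia) Ey ltac:(lia) EN Ec)
    as [HQ HWQ].
  assert (Hu := position_u _ _ _ _ _ _ _ _ _ H).
  destruct (Nat.eqb_spec l 0) as [->|Hl0].
  - apply (K _ _ _ _ _ HQ); [lia|]. intros t Ht.
    specialize (HW t Ht). specialize (HW' t). specialize (HWQ t). lia.
  - apply (IH l Hl (S (u l)) _ _ _ _ p HQ); [lia|rewrite upd_eq; lia| |exact K].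
    intros t Ht. specialize (HW t Ht). specialize (HW' t). specialize (HWQ t).
    assert (D := Nat.div_mod_eq t (S w)). assert (D' := Nat.mod_upper_bound t (S w) ltac:(lia)).
    set (k := t / S w) in *. set (r := t mod S w) in *.
    destruct (lt_eq_lt_dec k l) as [[C|C]|C].
    + destruct (Nat.leb_spec (l * S w + S (u l)) t); [nia|]. lia.
    (* Inside group [l] the interval given up by the used element pays for the next point. *)
    + subst l. destruct (Nat.leb_spec (k * S w + S (u k)) t); [|lia].
      destruct (Nat.leb_spec t (k * S w + w)); [simpl in HWQ; lia|nia].
    + destruct (l * S w + S (u l) <=? t); lia.
Qed.

(** A bound on the weight one cascade adds at coordinate [t]: its first point, then the possible
    descents. *)
Definition gain (w J t : nat) : nat :=
  (if S J * S w + 0 <=? t then 1 else 0) + pred (Nat.min (t / S w) (S J)).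

(** Room kept free at coordinate [t]. Below the top region, each of the [b] chains still to be won
    may cost [t / S w - 1] descents and one answering point; in the top region, [J] descents each,
    with [a] for everything else. *)
Definition reserve (w J a b t : nat) : nat :=
  if S J * S w <=? t then J * b + a else b * (t / S w).

Lemma gain_reserve (w J a b n t : nat) : S w <= t -> n < b -> b + n < a ->
  S n * gain w J t <= reserve w J a b t.
Proof.
  intros Ht Hn Ha. unfold gain, reserve. rewrite Nat.add_0_r.
  assert (1 <= t / S w) by (apply Nat.div_le_lower_bound; lia).
  destruct (Nat.leb_spec (S J * S w) t) as [C|C].
  - assert (S J <= t / S w) by (apply Nat.div_le_lower_bound; lia).
    rewrite Nat.min_r by lia. simpl pred. nia.
  - assert (t / S w < S J) by (apply Nat.Div0.div_lt_upper_bound; lia).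
    rewrite Nat.min_l by lia. nia.
Qed.

(** One round: [n] cascades are done and [k] remain. Each secures one chain and uses at most one
    element of group 0. *)
Lemma cascades alg w target J a b m c : online alg -> m <= b -> b + m <= a ->
  forall k n N thr key u p, n + k = m ->
  position alg w J N thr key u p (c + n) -> p <= n ->
  (forall t, S w <= t -> weight thr key N t + reserve w J a b t <= w + n * gain w J t) ->
  (forall N' thr' key' u' p', position alg w J N' thr' key' u' p' (c + m) -> p' <= m ->
     (forall t, S w <= t -> weight thr' key' N' t + reserve w J a b t <= w + m * gain w J t) ->
     forced alg w target) ->
  forced alg w target.
Proof.
  intros Ho Hmb Ha k. induction k as [|k IH]; intros n N thr key u p Hn H Hp HW K.
  { rewrite Nat.add_0_r in Hn. subst n. apply (K _ _ _ _ _ H); auto. }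
  apply (cascade alg w target J (c + n) (fun t => w + S n * gain w J t - reserve w J a b t) Ho)
    with (j := S J) (s := 0) (N := N) (thr := thr) (key := key) (u := u) (p := p); auto; try lia.
  - intros t Ht. assert (A := gain_reserve w J a b n t Ht ltac:(lia) ltac:(lia)). lia.
  - intros t Ht. specialize (HW t Ht). rewrite (Nat.mul_succ_l n), <- Nat.add_assoc.
    fold (gain w J t). lia.
  - intros N' thr' key' u' p' H' Hp' HW'.
    apply (IH (S n) N' thr' key' u' p'); auto; try lia.
    + replace (c + S n) with (S (c + n)) by lia. exact H'.
    + intros t Ht. specialize (HW' t Ht). specialize (HW t Ht).
      assert (n * gain w J t <= S n * gain w J t) by nia. lia.
Qed.

(** The [p] promised points are presented as twins in the fresh group [J]; afterwards no promise is
    open. *)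
Lemma batch alg w target J u c : online alg -> 1 <= J -> u J = 0 ->
  forall p N thr key, position alg w J N thr key u p c ->
  (forall x, x < N -> key x < top_key w -> key x / S w = J -> thr x = u 0) ->
  (forall x, x < N -> thr x <= J * S w) ->
  cnt (fun x => key x = J * S w + w) N + p <= w ->
  (forall t, S w <= t -> weight thr key N t + (if t <? S J * S w then p else 0) <= w) ->
  (forall N' thr' key', position alg w J N' thr' key' u 0 c ->
     (forall t, weight thr' key' N' t
        <= weight thr key N t + (if t <? S J * S w then p else 0)) -> forced alg w target) ->
  forced alg w target.
Proof.
  intros Ho HJ1 HuJ p. induction p as [|p IH]; intros N thr key H Hnew Hthr Hcnt HW K.
  { apply (K N thr key H). intro t. lia. }
  assert (HJ := po_J _ _ _ _ _ _ _ _ _ H).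
  assert (H0 := position_u _ _ _ _ _ _ _ _ _ H 0).
  apply (add_lower alg w J N thr key u p c Ho H HJ1 HuJ Hnew Hthr Hcnt HW). intro HP.
  set (thr' := upd thr N (u 0)) in *. set (key' := upd key N (J * S w + w)) in *.
  assert (Et : forall x, x < N -> thr' x = thr x) by (intros; apply upd_neq; lia).
  assert (Ek : forall x, x < N -> key' x = key x) by (intros; apply upd_neq; lia).
  assert (HW' : forall t, weight thr' key' (S N) t
     <= weight thr key N t + (if t <? S J * S w then 1 else 0)).
  { intro t. assert (A := weight_S N thr key (u 0) (J * S w + w) t). fold thr' key' in A.
    destruct (Nat.ltb_spec t (S J * S w)).
    - destruct ((u 0 <=? t) && (t <=? J * S w + w)); lia.
    - destruct (Nat.leb_spec t (J * S w + w)); [lia|]. rewrite andb_false_r in A. lia. }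
  apply (IH (S N) thr' key' HP).
  - intros x Hx. destruct (Nat.eq_dec x N) as [->|].
    + intros _ _. apply upd_eq.
    + rewrite Ek, Et by lia. apply Hnew. lia.
  - intros x Hx. destruct (Nat.eq_dec x N) as [->|].
    + unfold thr'. rewrite upd_eq. nia.
    + rewrite Et by lia. apply Hthr. lia.
  - assert (A : cnt (fun x => key' x = J * S w + w) (S N) <= cnt (fun x => key x = J * S w + w) N + 1).
    { apply cnt_upd_S. intros x Hx. rewrite Ek by lia. tauto. }
    lia.
  - intros t Ht. specialize (HW t Ht). specialize (HW' t). destruct (t <? S J * S w); lia.
  - intros N' thr'' key'' H' HW''. apply (K _ _ _ H'). intro t. specialize (HW'' t). specialize (HW' t).
    destruct (t <? S J * S w); lia.
Qed.

Lemma position_next alg w J N thr key u p c : S J <= w ->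
  position alg w J N thr key u p c -> position alg w (S J) N thr key u p c.
Proof.
  intros HJ H. assert (HuS := po_u _ _ _ _ _ _ _ _ _ H (S J) ltac:(lia)).
  constructor; try apply H; auto.
  - intros x Hx. destruct (po_key _ _ _ _ _ _ _ _ _ H x Hx) as [[j [s [A [B C]]]]|B]; [left|auto].
    exists j, s. auto.
  - intros x Hx E. destruct (po_thr_up _ _ _ _ _ _ _ _ _ H x Hx E) as [j [s [A B]]].
    exists j, s. split; [lia|auto].
  - intros y j s Hy Hj E Hs. apply (po_used _ _ _ _ _ _ _ _ _ H y j s); auto.
    destruct (Nat.eq_dec j (S J)) as [->|]; lia.
  - intros j Hj. apply (po_u _ _ _ _ _ _ _ _ _ H). lia.
Qed.

(** A round with [m] cascades turns [(a, b)] into [(m, b - m)]. As [m >= 1], the induction on [b]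
    ends, and [J + b <= w] keeps the group index in range. *)
Lemma level alg w target : online alg -> forall b J a N thr key u c,
  position alg w J N thr key u 0 c -> J + b <= w -> b * b + a * b <= a * a ->
  (forall t, S w <= t -> weight thr key N t + reserve w J a b t <= w) ->
  target <= c + b -> forced alg w target.
Proof.
  intros Ho b. induction b as [b IH] using (well_founded_induction lt_wf).
  intros J a N thr key u c H HJb Hab HW Ht.
  destruct (Nat.eq_dec b 0) as [->|Hb].
  { apply (position_forced _ _ _ _ _ _ _ _ _ _ H); [intros t Hwt; specialize (HW t Hwt); lia|].
    right. assert (A := po_col _ _ _ _ _ _ _ _ _ H). lia. }
  assert (Hba : b < a) by nia.
  set (m := Nat.min b (a - b)).
  assert (Hm : 1 <= m /\ m <= b /\ b + m <= a) by (unfold m; lia).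
  (* If [m = b] nothing is left to win; otherwise the new pair is [(a - b, 2 b - a)] and the
     quadratic form is preserved. *)
  assert (Hab' : (b - m) * (b - m) + m * (b - m) <= m * m).
  { unfold m. destruct (Nat.min_spec b (a - b)) as [[_ ->]|[C ->]]; [rewrite Nat.sub_diag; nia|].
    assert (E : exists d e, a = b + d /\ b = d + e) by (exists (a - b), (b - (a - b)); lia).
    destruct E as [d [e [-> E]]]. replace (b + d - b) with d by lia. replace (b - d) with e by lia.
    subst b. nia. }
  clearbody m. destruct Hm as [Hm1 [Hm2 Hm3]].
  apply (cascades alg w target J a b m c Ho Hm2 Hm3) with (k := m) (n := 0) (1 := eq_refl)
    (N := N) (thr := thr) (key := key) (u := u) (p := 0); auto.
  { rewrite Nat.add_0_r. exact H. }
  { intros t Hwt. specialize (HW t Hwt). lia. }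
  clear N thr key u H HW. intros N thr key u p H Hp HW.
  assert (HJw := po_J _ _ _ _ _ _ _ _ _ H).
  assert (Hu := position_u _ _ _ _ _ _ _ _ _ H).
  assert (HuS := po_u _ _ _ _ _ _ _ _ _ H (S J) ltac:(lia)).
  assert (HN := position_next alg w J N thr key u p (c + m) ltac:(lia) H).
  (* What the round leaves free covers the answering points and the next reserve. In lower groups
     this balances exactly, as [m * pred k + m = m * k]; from group [S J] on it is the condition
     [b + m <= a]. *)
  assert (HD : forall t, S w <= t -> weight thr key N t + (if t <? S (S J) * S w then p else 0)
     + reserve w (S J) m (b - m) t <= w).
  { intros t Hwt. specialize (HW t Hwt). unfold gain, reserve in *. rewrite Nat.add_0_r in HW.
    assert (1 <= t / S w) by (apply Nat.div_le_lower_bound; lia).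
    destruct (Nat.leb_spec (S J * S w) t) as [C|C].
    - assert (S J <= t / S w) by (apply Nat.div_le_lower_bound; lia).
      rewrite Nat.min_r in HW by lia. simpl pred in HW.
      destruct (Nat.leb_spec (S (S J) * S w) t) as [C'|C'];
        destruct (Nat.ltb_spec t (S (S J) * S w)); try lia.
      + assert (S J * (b - m) + S J * m = S J * b) by (rewrite <- Nat.mul_add_distr_l; f_equal; lia). nia.
      + assert (t / S w < S (S J)) by (apply Nat.Div0.div_lt_upper_bound; lia).
        assert (t / S w = S J) as -> by lia.
        assert (S J * (b - m) + S J * m = S J * b) by (rewrite <- Nat.mul_add_distr_l; f_equal; lia). nia.
    - assert (t / S w < S J) by (apply Nat.Div0.div_lt_upper_bound; lia).
      rewrite Nat.min_l in HW by lia.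
      destruct (Nat.leb_spec (S (S J) * S w) t) as [C'|C']; [nia|].
      destruct (Nat.ltb_spec t (S (S J) * S w)); [|lia].
      set (k := t / S w) in *.
      assert ((b - m) * k + m * k = b * k) by (rewrite <- Nat.mul_add_distr_r; f_equal; lia).
      assert (m * pred k + m = m * k) by (destruct k; [lia|simpl pred; nia]). lia. }
  apply (batch alg w target (S J) u (c + m) Ho ltac:(lia) HuS p N thr key HN).
  - intros x Hx Hk E. exfalso.
    destruct (po_key _ _ _ _ _ _ _ _ _ H x Hx) as [[j [s [A [B C]]]]|B]; [|lia].
    rewrite B, group_div in E by (specialize (Hu j); lia). lia.
  - intros x Hx. destruct (Nat.eq_dec (key x) (top_key w)) as [E|E].
    + destruct (po_thr_up _ _ _ _ _ _ _ _ _ H x Hx E) as [j [s [A [B C]]]].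
      destruct (Nat.eq_dec j (S J)) as [->|]; [lia|].
      specialize (Hu j). assert (D := group_lt w j (S J) s 0 ltac:(lia) ltac:(lia)). lia.
    + assert (A := po_thr_low _ _ _ _ _ _ _ _ _ H x Hx).
      assert (B := position_key_le _ _ _ _ _ _ _ _ _ H x Hx).
      specialize (A ltac:(lia)). specialize (Hu 0). nia.
  - rewrite cnt_none; [lia|]. intros x Hx E.
    destruct (po_key _ _ _ _ _ _ _ _ _ H x Hx) as [[j [s [A [B C]]]]|B].
    + rewrite B in E. apply group_inj in E; try lia. specialize (Hu j). lia.
    + assert (D := top_key_gt w (S J) w ltac:(lia) ltac:(lia)). lia.
  - intros t Hwt. specialize (HD t Hwt). lia.
  - intros N' thr' key' H' HW'.
    apply (IH (b - m) ltac:(lia) (S J) m N' thr' key' u (c + m)); auto; try lia.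
    intros t Hwt. specialize (HD t Hwt). specialize (HW' t). lia.
Qed.

(** Play starts with [w] minimal points on [w] chains and the pair [(w, b)]; beyond group 0 the full
    width [w] is free. *)
Lemma spoiler alg w b : online alg -> 0 < w -> b * b + w * b <= w * w -> forced alg w (w + b).
Proof.
  intros Ho Hw Hb.
  assert (HP : position alg w 0 w (fun _ => 0) (fun _ => w) (fun _ => 0) 0 0).
  { assert (A := top_key_gt w 0 w ltac:(lia) ltac:(lia)). constructor; auto; try lia.
    - intros x Hx. left. exists 0, w. auto.
    - intro j. simpl. apply cnt_bound.
    - intros t Ht. unfold weight.
      assert (B := cnt_bound (fun _ => 0 <= t /\ t <= w) w). destruct (0 <=? t); lia. }
  assert (HW : forall t, S w <= t -> weight (fun _ => 0) (fun _ => w) w t = 0).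
  { intros t Ht. apply cnt_none. intros; lia. }
  set (lt := ltk (fun _ => 0) (fun _ => w)).
  destruct (classic (chain_partition w lt (fun i => alg i lt))) as [Hch|Hch].
  2: { apply (position_forced _ _ _ _ _ _ _ _ _ _ HP); auto. intros t Ht. rewrite HW; lia. }
  assert (Hnum : forall k, k <= w -> num_chains k (fun i => alg i lt) = k).
  { induction k as [|k IH]; intro Hk; [reflexivity|]. rewrite num_chains_new; [rewrite IH; lia|].
    intros x Hx E. destruct (Hch x k) as [C|C]; auto; try lia; discriminate C. }
  apply (level alg w (w + b) Ho b 0 w w (fun _ => 0) (fun _ => w) (fun _ => 0) w); auto.
  - apply position_weaken with 0; auto. fold lt. rewrite Hnum; lia.
  - nia.
  - intros t Ht. rewrite HW by auto. unfold reserve. destruct (Nat.leb_spec (1 * S w) t); lia.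
Qed.

(** * Both bounds on the value of the game *)

Open Scope R_scope.

Theorem theorem1 (w : nat) (hw : (0 < w)%nat) :
  (exists alg : nat -> (nat -> nat -> bool) -> nat,
     online alg /\
     forall (N : nat) (lt : nat -> nat -> bool),
       is_strict_order N lt -> up_growing N lt -> semi_order N lt -> width_le N lt w ->
       chain_partition N lt (fun i => alg i lt) /\
       (num_chains N (fun i => alg i lt) <= floor_nat (phi * INR w))%nat)
  /\
  (forall alg : nat -> (nat -> nat -> bool) -> nat,
     online alg ->
     exists (N : nat) (lt : nat -> nat -> bool),
       is_strict_order N lt /\ up_growing N lt /\ semi_order N lt /\ width_eq N lt w /\
       (~ chain_partition N lt (fun i => alg i lt) \/
        (floor_nat (phi * INR w) <= num_chains N (fun i => alg i lt))%nat)).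
Proof.
  split.
  - exists best_fit. split; [apply best_fit_online|]. intros N lt Hso Hup Hsemi Hw.
    split; [apply best_fit_chains; auto|apply best_fit_bound; auto].
  - intros alg Ho.
    assert (Hpos := pos_INR w).
    assert (Hphi : 1 < phi) by (unfold phi; assert (A := sqrt5_bounds); lra).
    assert (Hfl := floor_nat_spec (phi * INR w)).
    assert (Hle : (w <= floor_nat (phi * INR w))%nat) by (apply Hfl; nra).
    assert (E : floor_nat (phi * INR w) = (w + (floor_nat (phi * INR w) - w))%nat) by lia.
    rewrite E. apply spoiler; auto. apply phi_mul_spec. rewrite <- E. apply Hfl; auto. nra.
Qed.
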